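(* Let $a\in(0,1)$ and $\delta\in[0,1)$, let $(u_n)_{n\in\mathbb{N}}\subseteq\mathbb{R}$ be a $\delta$-sublacunary sequence, and let $(I_n)_{n\in\mathbb{N}}$ be a sequence of sets such that $\lambda(I_n)=n^{-a}$, and there is $\ell\in\mathbb{N}$ such that each $I_n\subseteq[0,1]$ is a union of at most $\ell$ intervals. For $y\in[0,1]$ let $\Lambda_y=\{n\in\mathbb{N}:\ \{u_ny\}\in I_n\}$. Then, if $\delta+a<1$, $$\lim_{N\to\infty}\frac{|\Lambda_y\cap[1,N]|}{N^{1-a}}=1$$ for almost every $y\in[0,1]$. In addition: (1) If $A\subseteq\mathbb{N}$ satisfies $\delta+a<\overline{\dim_{\mathrm M}}(A)$, then for almost every $y\in[0,1]$, $$\overline{\dim_{\mathrm M}}(A\cap\Lambda_y)=\overline{\dim_{\mathrm M}}(A)+\dim_{\mathrm M}(\Lambda_y)-1=\overline{\dim_{\mathrm M}}(A)-a.$$ Also, if $\dim_{\mathrm M}(A)$ exists, $\overline{\dim_{\mathrm M}}(A\cap\Lambda_y)$ can be replaced by $\dim_{\mathrm M}(A\cap\Lambda_y)$. (2) If $A\subseteq\mathbb{N}$ satisfies $\overline{\dim_{\mathrm M}}(A)<a$ and $\delta=0$, then for almost every $y\in[0,1]$, $\dim_{\mathrm M}(A\cap\Lambda_y)=0$.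
   Context: $\mathbb{N}=\{1,2,3,\dots\}$; $\lambda$ is Lebesgue measure on $[0,1]$, and ''almost every'' refers to $\lambda$; $\{x\}$ denotes the fractional part of the real number $x$. For $\delta\ge 0$, a sequence $(u_n)_{n\in\mathbb{N}}$ of positive real numbers is $\delta$-sublacunary if there is $c\in(0,1)$ such that $u_{n+1}/u_n\ge 1+cn^{-\delta}$ for every $n\in\mathbb{N}$. For a non-empty $A\subseteq\mathbb{N}$, the lower and upper mass dimensions are $$\underline{\dim_{\mathrm M}}(A)=\liminf_{N\to\infty}\frac{\log|A\cap[1,N]|}{\log N},\qquad \overline{\dim_{\mathrm M}}(A)=\limsup_{N\to\infty}\frac{\log|A\cap[1,N]|}{\log N}.$$ Equivalently, they are the suprema of the $\gamma\ge0$ for which $\liminf_{N\to\infty}|A\cap[1,N]|/N^\gamma>0$, respectively $\limsup_{N\to\infty}|A\cap[1,N]|/N^\gamma>0$. If the two values coincide, the common value is denoted $\dim_{\mathrm M}(A)$ and one says that the mass dimension of $A$ exists.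
   Formalization: The limit of |Λ_y∩[1,N]|/N^{1-a} is stated as 1/(1-a) instead of 1, since the sum of n^{-a} over n≤N is asymptotic to N^{1-a}/(1-a); the value 1 fails, e.g. for u_n=2^n, I_n=[0,n^{-a}]. *)

(* Defs.v *)
From HB Require Import structures.
From mathcomp Require Import all_boot all_order all_algebra.
From mathcomp Require Import finmap.
From mathcomp Require Import all_classical all_reals all_analysis.

Set Implicit Arguments.
Unset Strict Implicit.
Unset Printing Implicit Defensive.

Import Order.TTheory GRing.Theory Num.Theory.
Import numFieldNormedType.Exports.

Local Open Scope classical_set_scope.
Local Open Scope ring_scope.

(* The index set is {1, 2, 3, ...}: sequences are functions on nat whose value
   at 0 is never used, and sets of indices are subsets of posnats. *)
Definition posnats : set nat := [set n | (0 < n)%N].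

Definition fracpart (R : realType) (x : R) : R := x - (Num.floor x)%:~R.

Definition sublacunary (R : realType) (delta : R) (u : nat -> R) : Prop :=
  [/\ 0 <= delta,
      forall n : nat, (0 < n)%N -> 0 < u n &
      exists c : R, [/\ 0 < c, c < 1 &
        forall n : nat, (0 < n)%N ->
          1 + c * n%:R `^ (- delta) <= u n.+1 / u n]].

(* Intervals of any kind (open, closed, half-open, degenerate) are allowed. *)
Definition union_of_intervals (R : realType) (l : nat) (X : set R) : Prop :=
  exists s : seq (interval R),
    (size s <= l)%N /\ X = \big[setU/set0]_(J <- s) [set` J].

Definition counting_fun (A : set nat) (N : nat) : nat :=
  #|` fset_set (A `&` [set n | (1 <= n <= N)%N]) |%fset.

(* Since ln 0 = 0 and x / 0 = 0, every term lies in [0, 1], so that the real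
   limn_inf and limn_sup below are the genuine ones. The convention ln 0 = 0
   affects only finitely many terms when A meets posnats; otherwise it gives
   dimension 0, which is the supremum in [0, +oo[ of the empty set of exponents
   gamma with |A `&` [1, N]| / N ^ gamma not tending to 0. *)
Definition mdim_seq (R : realType) (A : set nat) (N : nat) : R :=
  ln (counting_fun A N)%:R / ln N%:R.

Definition lower_mdim (R : realType) (A : set nat) : R :=
  limn_inf (@mdim_seq R A).

Definition upper_mdim (R : realType) (A : set nat) : R :=
  limn_sup (@mdim_seq R A).

(* "The mass dimension of A exists and equals d". *)
Definition is_mdim (R : realType) (A : set nat) (d : R) : Prop :=
  lower_mdim R A = d /\ upper_mdim R A = d.

Definition hits (R : realType) (u : nat -> R) (I : nat -> set R) (y : R) :
    set nat :=
  [set n | (0 < n)%N /\ I n (fracpart (u n * y))].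

Definition ae01 (R : realType) (P : R -> Prop) : Prop :=
  {ae (@lebesgue_measure R), forall y : R, y \in `[0, 1] -> P y}.

(* Main.v *)
Require Import Defs.
From HB Require Import structures.
From mathcomp Require Import all_boot all_order all_algebra.
From mathcomp Require Import finmap.
From mathcomp Require Import all_classical all_reals all_analysis.
From mathcomp Require Import measurable_realfun ring lra.

Set Implicit Arguments.
Unset Strict Implicit.
Unset Printing Implicit Defensive.

Import Order.TTheory GRing.Theory Num.Theory.
Import numFieldNormedType.Exports.

Local Open Scope classical_set_scope.
Local Open Scope ring_scope.

(** The theorem is a second-moment argument. Put E_n = {y : {u_n y} in I_n}
    and p_n = n^(-a), the length of I_n. For a set A of indices, the number of
    hits S_N(y) = |{n in A : n <= N, y in E_n}| is compared with the value
    M_N = sum of p_n over n in A, n <= N, which the uniform distribution of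
    {u_n y} suggests.

    Correlations decay. The set E_n is periodic with period 1/u_n and meets each
    period in length p_n/u_n; so it meets an interval J in length
    p_n |J| + O(p_n/u_n), the error coming from the two periods that contain the
    endpoints of J ([discrepancy_interval]). For m <= n, the part of E_m in
    [0, 1] is a union of O(u_m) intervals, so that E_m and E_n have covariance
    O(p_n u_m/u_n) ([hitset_cov], [hit_cov]). Sublacunarity gives
    sum_(m <= n) u_m/u_n = O(n^delta) ([sublacunary_sum]). Summing up, the mean
    of (S_N - M_N)^2 over [0, 1] is O(N^delta M_N) ([second_moment]), and
    Chebyshev's inequality bounds the measure of the set where
    |S_N - M_N| > t by O(N^delta M_N/t^2) ([deviation]). By the Borel-Cantelli
    lemma, |S_N - M_N| <= t_N eventually along any sequence of values of N for
    which N^delta M_N/t_N^2 is summable ([ae_deviation]).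

    The claims are three choices of N and t_N. As S_N is nondecreasing in N,
    information along a sequence of values of N carries over to all N.
    - For all indices and N = k^r with r large, t_N = M_N/k is allowed because
      delta + a < 1; hence S_N ~ M_N ~ N^(1-a)/(1-a)
      ([ae_counting_asymptotics]).
    - If |A cap [1, N]| = O(N^g) with g > a, then M_N = O(N^(g-a)); along
      N = 2^k one may take t_N slightly above N^(g-a) as long as g - a >= delta.
      So the upper dimension of the hits in A is almost surely at most theta as
      soon as theta >= delta and A has upper dimension at most theta + a
      ([ae_upper_mdim_le]). For theta = dim A - a this is half of the dimension
      formula; for theta = delta = 0 it is the vanishing of the dimension.
    - If |A cap [1, N]| >= N^g with g > delta + a along a sequence of N growing
      at least like 2^k, then M_N >= N^(g-a) there and t_N = M_N/2 is allowed
      ([ae_count_ge]); this gives the other half of the dimension formula. *)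

Local Notation mu := (@lebesgue_measure _).

(** * Lengths of sets of finite measure *)

Section FiniteLength.
Variable R : realType.
Implicit Types V W T : set R.

Definition len V : R := fine (mu V).

(** The real-valued [len] is additive and monotone only on such sets, since
    [fine] sends an infinite measure to 0. *)
Definition finlen V : Prop := measurable V /\ (mu V < +oo)%E.

Lemma lenE V : finlen V -> mu V = (len V)%:E.
Proof.
by move=> [mV Vy]; rewrite fineK// ge0_fin_numE.
Qed.

Lemma len_ge0 V : 0 <= len V. Proof. by rewrite fine_ge0. Qed.

Lemma finlenS V W : measurable V -> V `<=` W -> finlen W -> finlen V.
Proof.
move=> mV VW [mW Wy]; split=> //; apply: le_lt_trans Wy.
by apply: le_measure => //; rewrite inE.
Qed.

Lemma finlenI V T : finlen V -> measurable T -> finlen (V `&` T).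
Proof.
move=> /[dup] fV [mV _] mT.
exact: finlenS (measurableI _ _ mV mT) (@subIsetl _ _ _) fV.
Qed.

Lemma le_len V W : measurable V -> finlen W -> V `<=` W -> len V <= len W.
Proof.
move=> mV fW VW; have fV := finlenS mV VW fW.
rewrite -lee_fin -!lenE//; apply: le_measure => //; rewrite inE //.
by case: fW.
Qed.

Lemma finlenU V W : finlen V -> finlen W -> finlen (V `|` W).
Proof.
move=> [mV Vy] [mW Wy]; split; first exact: measurableU.
rewrite (le_lt_trans (measureU2 (@lebesgue_measure R) mV mW))//.
exact: lte_add_pinfty.
Qed.

Lemma lenU V W : finlen V -> finlen W ->
  len (V `|` W) = len V + len W - len (V `&` W).
Proof.
move=> /[dup] fV [mV Vy] /[dup] fW [mW Wy].
have fI := finlenI fV mW.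
have := @measureUfinl _ _ _ (@lebesgue_measure R) V W mV mW Vy.
by rewrite /= (lenE fV) (lenE fW) (lenE fI) (lenE (finlenU fV fW)) => -[].
Qed.

Lemma lenU_disj V W : finlen V -> finlen W -> V `&` W = set0 ->
  len (V `|` W) = len V + len W.
Proof. by move=> fV fW d; rewrite lenU// d /len measure0 subr0. Qed.

Lemma finlen_itv (b b' : bool) (s t : R) :
  finlen [set` Interval (BSide b s) (BSide b' t)].
Proof.
split; first exact: measurable_itv.
by rewrite lebesgue_measure_itv; case: ifP => // _; rewrite -EFinB ltry.
Qed.

Lemma len_itv (b b' : bool) (s t : R) : s <= t ->
  len [set` Interval (BSide b s) (BSide b' t)] = t - s.
Proof.
move=> st; rewrite /len lebesgue_measure_itv/= lte_fin.
case: ltP => //= ts; lra.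
Qed.

(** Both sides are measures in [B] that agree on half-open intervals. *)
Lemma lebesgue_measure_affine (u k : R) (B : set R) : 0 < u -> measurable B ->
  mu ((fun y => u * y - k) @^-1` B) = ((u^-1)%:E * mu B)%E.
Proof.
move=> u0 mB.
pose f : measurableTypeR R -> measurableTypeR R := fun y => u * y - k.
have mf : measurable_fun setT f.
  by apply: measurable_funB => //; apply: measurable_funM.
have un : 0 <= u by lra.
pose nu := mscale (NngNum un) (pushforward mu f).
have : mu B = nu mf B.
  apply: lebesgue_measure_unique => // _ [[a b]] _ <-.
  rewrite -[RHS]/(u%:E * mu (f @^-1` `]a, b]))%E.
  have -> : f @^-1` `]a, b] = `](a + k) / u, (b + k) / u]%classic.
    apply/seteqP; split=> x /=; rewrite !in_itv/= /f ltr_pdivrMr// ler_pdivlMr//;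
    move=> /andP[h1 h2]; apply/andP; split; lra.
  rewrite !lebesgue_measure_itv/= !lte_fin ltr_pM2r ?invr_gt0// ltrD2r.
  case: ifP => _; last by rewrite mule0.
  rewrite -!EFinB -EFinM; congr EFin; field; lra.
rewrite -[nu mf B]/(u%:E * mu (f @^-1` B))%E => ->.
by rewrite muleA -EFinM mulVf ?mul1e// gt_eqF.
Qed.

End FiniteLength.

(** * Distribution of a periodic set in an interval *)

Section Periodic.
Variable R : realType.
Implicit Types (I V W T : set R) (u : R).

Definition hitset u I : set R := [set y | I (fracpart (u * y))].

Lemma measurable_hitset u I : measurable I -> measurable (hitset u I).
Proof.
move=> mI; rewrite /hitset.
have mfl : measurable_fun setT (fun y : R => (Num.floor y)%:~R : R).
  apply: nondecreasing_measurable => // x y xy /=.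
  by rewrite ler_int le_floor.
have mf : measurable_fun setT (fun y : R => fracpart (u * y)).
  rewrite /fracpart; apply: measurable_funB; first exact: measurable_funM.
  apply: (measurableT_comp mfl); exact: measurable_funM.
by have := mf measurableT _ mI; rewrite setTI.
Qed.

(** On the period where [u * y] has integral part [k], the fractional part
    is the affine function [u * y - k]. *)
Lemma hitset_cell u I (k : int) : 0 < u ->
  hitset u I `&` `[k%:~R / u, (k%:~R + 1) / u[%classic =
  (fun y => u * y - k%:~R) @^-1` (I `&` `[0, 1[%classic).
Proof.
move=> u0; apply/seteqP; split=> y /=; rewrite /hitset /= !in_itv/=.
  rewrite ler_pdivrMr// ltr_pdivlMr// (mulrC y) => -[Iy /andP[h1 h2]].
  have fE : Num.floor (u * y) = k.
    by apply: floor_def; rewrite h1 /= intrD.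
  by move: Iy; rewrite /fracpart fE => Iy; split=> //; apply/andP; split; lra.
move=> [Iy /andP[h1 h2]].
have fE : Num.floor (u * y) = k.
  by apply: floor_def; rewrite intrD; apply/andP; split; lra.
split; first by rewrite /fracpart fE.
by rewrite ler_pdivrMr// ltr_pdivlMr//; apply/andP; split; lra.
Qed.

Lemma len_setI_co01 I : measurable I -> I `<=` `[0, 1]%classic ->
  len (I `&` `[0, 1[%classic) = len I.
Proof.
move=> mI I01.
have f01 : finlen (`[0, 1]%classic : set R) by exact: finlen_itv.
have fI : finlen I := finlenS mI I01 f01.
have f1 : finlen (I `&` `[0, 1[%classic) by apply: finlenI => //.
have f2 : finlen (I `&` `[1, 1]%classic) by apply: finlenI => //.
have IE : I = (I `&` `[0, 1[%classic) `|` (I `&` `[1, 1]%classic).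
  rewrite -setIUr; apply/esym/setIidPl => y /I01; rewrite /= !in_itv/=.
  by case: ltP => [y1|y1] /andP[y0 y1']; [left; rewrite y0|right; rewrite y1'].
rewrite [RHS]/len [in RHS]IE -/(len _) lenU_disj//; last first.
  rewrite -subset0 => y [[_ /=]]; rewrite in_itv/= => /andP[_ h1] [_ /=].
  rewrite in_itv/=; lra.
have := le_len (proj1 f2) (finlen_itv true false 1 1) (@subIsetr _ _ _).
rewrite len_itv// subrr => h; have := len_ge0 (I `&` `[1, 1]); lra.
Qed.

Lemma len_hitset_cell u I (k : int) : 0 < u -> measurable I ->
  I `<=` `[0, 1]%classic ->
  len (hitset u I `&` `[k%:~R / u, (k%:~R + 1) / u[%classic) = len I / u.
Proof.
move=> u0 mI I01; rewrite hitset_cell// /len lebesgue_measure_affine//; last first.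
  exact: measurableI.
have fI : finlen (I `&` `[0, 1[%classic).
  apply: finlenI => //; exact: finlenS mI I01 (finlen_itv _ _ _ _).
by rewrite (lenE fI) -EFinM/= len_setI_co01// mulrC.
Qed.

Lemma len_hitset_cells u I (k : int) (j : nat) : 0 < u -> measurable I ->
  I `<=` `[0, 1]%classic ->
  len (hitset u I `&` `[k%:~R / u, (k%:~R + j%:R) / u[%classic) =
  j%:R * (len I / u).
Proof.
move=> u0 mI I01; elim: j => [|j IH].
  by rewrite addr0 set_itvco0 setI0 /len measure0 mul0r.
have kj : (k%:~R + j%:R : R) = (k + j%:Z)%:~R by rewrite intrD.
have -> : `[k%:~R / u, (k%:~R + j.+1%:R) / u[%classic =
    `[k%:~R / u, (k%:~R + j%:R) / u[%classic `|`
    `[(k + j%:Z)%:~R / u, ((k + j%:Z)%:~R + 1) / u[%classic :> set R.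
  have ui : 0 < u^-1 by rewrite invr_gt0.
  rewrite -kj -addrA -natr1; apply/seteqP; split=> y /=; rewrite !in_itv/=.
    by case: (ltP y ((k%:~R + j%:R) / u)) => h /andP[h1 h2]; [left; rewrite h1|right].
  have h1 : k%:~R / u <= (k%:~R + j%:R) / u by rewrite ler_pM2r// lerDl.
  have h2 : (k%:~R + j%:R) / u <= (k%:~R + (j%:R + 1)) / u.
    by rewrite ler_pM2r// lerD2l lerDl.
  move=> [] /andP[h3 h4]; apply/andP; split; lra.
rewrite setIUr lenU_disj ?len_hitset_cell// ?IH; last 3 first.
- by apply: finlenS (@subIsetr _ _ _) (finlen_itv _ _ _ _);
  apply: measurableI => //; exact: measurable_hitset.
- by apply: finlenS (@subIsetr _ _ _) (finlen_itv _ _ _ _);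
  apply: measurableI => //; exact: measurable_hitset.
- rewrite -subset0 => y [[_ /=]]; rewrite in_itv/= kj => /andP[_ h1] [_ /=].
  rewrite in_itv/=; lra.
by rewrite -natr1 mulrDl mul1r.
Qed.

(** A bounded convex set differs from an open interval by its endpoints only;
    working with convex sets avoids a case analysis on kinds of intervals, and
    convexity is stable under intersection and affine preimage. *)
Lemma bounded_interval_itv V : is_interval V -> V !=set0 ->
  (exists a b : R, V `<=` `[a, b]%classic) ->
  exists s t : R, [/\ s <= t, `]s, t[%classic `<=` V & V `<=` `[s, t]%classic].
Proof.
move=> iV [x Vx] [a [b Vab]].
have hl : has_lbound V by exists a => y /Vab /=; rewrite in_itv/= => /andP[].
have hu : has_ubound V by exists b => y /Vab /=; rewrite in_itv/= => /andP[].
have sub : V `<=` `[inf V, sup V]%classic.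
  by move=> y Vy /=; rewrite in_itv/= ge_inf// ub_le_sup.
exists (inf V), (sup V); split=> //.
  by have := sub _ Vx; rewrite /= in_itv/= => /andP[]; exact: le_trans.
have V0 : V !=set0 by exists x.
move=> y /=; rewrite in_itv/= => /andP[/(inf_lt V0) [v Vv vy]].
move=> /(sup_gt V0) [w Vw yw].
by apply: (iV v w) => //; rewrite !ltW.
Qed.

(** The error made by replacing [T] with a set of constant density [p]. *)
Definition discrepancy T p V : R := `|len (V `&` T) - p * len V|.

(** The set meets every full period in length [len I / u], and at most two
    periods meet [V] without being contained in it. *)
Lemma discrepancy_interval u I V : 0 < u -> measurable I -> I `<=` `[0, 1]%classic ->
  is_interval V -> (exists a b : R, V `<=` `[a, b]%classic) ->
  discrepancy (hitset u I) (len I) V <= 2 * (len I / u).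
Proof.
move=> u0 mI I01 iV bV; rewrite /discrepancy.
have p0 : 0 <= len I := len_ge0 I.
have pu0 : 0 <= len I / u by rewrite divr_ge0// ltW.
have [->|/set0P V0] := eqVneq V set0.
  by rewrite set0I /len measure0 mulr0 subrr normr0 mulr_ge0.
have [s [t [st sub1 sub2]]] := bounded_interval_itv iV V0 bV.
have mV : measurable V := is_interval_measurable iV.
have fV : finlen V := finlenS mV sub2 (finlen_itv _ _ _ _).
have mT := @measurable_hitset u _ mI.
have lV : len V = t - s.
  apply/eqP; rewrite eq_le.
  rewrite -{1}(len_itv true false st) le_len//=; last exact: finlen_itv.
  by rewrite -(len_itv false true st) le_len.
have [k1 hk1] : exists k : int, k%:~R <= u * s < k%:~R + 1.
  exists (Num.floor (u * s)).
  by rewrite floor_le /= -[X in _ + X]/(1%:~R) -intrD floorD1_gt.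
have [k2 hk2] : exists k : int, k%:~R <= u * t < k%:~R + 1.
  exists (Num.floor (u * t)).
  by rewrite floor_le /= -[X in _ + X]/(1%:~R) -intrD floorD1_gt.
move: hk1 hk2 => /andP[k1l k1r] /andP[k2l k2r].
have ust : u * s <= u * t by rewrite ler_pM2l.
have k12 : k1 <= k2.
  have : (k1%:~R : R) < (k2 + 1)%:~R by rewrite intrD; lra.
  by rewrite ltr_int ltzD1.
have [j jE] : exists j : nat, (k2%:~R = k1%:~R + j%:R :> R).
  exists `|k2 - k1|%N; rewrite -[X in _ + X]/(_%:Z%:~R) -intrD; congr intr.
  by rewrite gez0_abs ?subr_ge0// subrKC.
have uE : len I * (t - s) = u * (t - s) * (len I / u).
  by field; rewrite gt_eqF.
rewrite lV ler_distl; apply/andP; split.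
  (* If k1 < k2, then V contains the periods strictly between k1 and k2; if
     k1 = k2, it is shorter than a period and the lower bound is not positive. *)
  have [j0|j1] := posnP j.
    have : (u * (t - s)) * (len I / u) <= 2 * (len I / u).
      apply: ler_wpM2r => //.
      have jE0 : k2%:~R = k1%:~R :> R by rewrite jE j0 addr0.
      rewrite jE0 in k2l k2r.
      lra.
    by move=> h; have := len_ge0 (V `&` hitset u I); lra.
  have jE2 : (j%:R = j.-1%:R + 1 :> R) by rewrite natr1 prednK.
  have := len_hitset_cells (k1 + 1) j.-1 u0 mI I01.
  have : len (hitset u I `&` `[(k1 + 1)%:~R / u, ((k1 + 1)%:~R + j.-1%:R) / u[)
     <= len (V `&` hitset u I).
    apply: le_len; [exact: measurableI| exact: finlenI |].
    move=> y [Ty /=]; rewrite in_itv/= intrD => /andP[h1 h2]; split=> //.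
    apply: sub1; rewrite /= in_itv/=; move: h1 h2.
    rewrite ler_pdivrMr// ltr_pdivlMr// => h1 h2.
    rewrite -(ltr_pM2l u0) -(ltr_pM2l u0 y); apply/andP; split; lra.
  move=> h hE; rewrite hE in h.
  have : (u * (t - s) - 2) * (len I / u) <= j.-1%:R * (len I / u).
    by apply: ler_wpM2r => //; lra.
  by rewrite mulrBl; lra.
(* V is contained in the union of the periods k1, ..., k2. *)
have h1 := len_hitset_cells k1 j.+1 u0 mI I01.
have h2 : len (V `&` hitset u I) <=
    len (hitset u I `&` `[k1%:~R / u, (k1%:~R + j.+1%:R) / u[).
  apply: le_len; first exact: measurableI.
    apply: finlenS (@subIsetr _ _ _)
      (finlen_itv true true (k1%:~R / u) ((k1%:~R + j.+1%:R) / u)).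
    exact: measurableI.
  move=> y [/sub2 /=]; rewrite in_itv/= -natr1 => /andP[h1' h2'] Ty; split=> //=.
  rewrite in_itv/= ler_pdivrMr// ltr_pdivlMr// (mulrC y).
  move: h1' h2'; rewrite -(ler_pM2l u0) -(ler_pM2l u0 y) => h1' h2'.
  apply/andP; split; lra.
have : j.+1%:R * (len I / u) <= (u * (t - s) + 2) * (len I / u).
  by apply: ler_wpM2r => //; rewrite -natr1; lra.
by rewrite mulrDl; lra.
Qed.

End Periodic.

(** * Distribution of a periodic set in unions of intervals *)

Section Unions.
Variable R : realType.
Implicit Types (I V W T : set R) (u p e : R).

Definition bounded_interval V :=
  is_interval V /\ exists a b : R, V `<=` `[a, b]%classic.

Lemma bounded_intervalI V W : is_interval V -> bounded_interval W ->
  bounded_interval (V `&` W).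
Proof.
move=> iV [iW [a [b Wab]]]; split; last by exists a, b => y [_ /Wab].
move=> x y [Vx Wx] [Vy Wy] z xzy; split; first exact: (iV x y).
exact: (iW x y).
Qed.

Lemma bounded_interval_finlen V : bounded_interval V -> finlen V.
Proof.
move=> [iV [a [b Vab]]].
exact: finlenS (is_interval_measurable iV) Vab (finlen_itv _ _ _ _).
Qed.

(** Inclusion-exclusion. *)
Lemma discrepancyU T p V W : measurable T -> finlen V -> finlen W ->
  discrepancy T p (V `|` W) <=
  discrepancy T p V + discrepancy T p W + discrepancy T p (V `&` W).
Proof.
move=> mT fV fW; rewrite /discrepancy setIUl !lenU//; [|exact: finlenI..].
have -> : V `&` T `&` (W `&` T) = V `&` W `&` T by rewrite setIACA setIid.
set a := len _; set b := len V; set c := len _; set d := len W.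
set x := len _; set y := len _.
have -> : a + c - x - p * (b + d - y) =
  (a - p * b) + (c - p * d) - (x - p * y) by ring.
apply: le_trans (ler_normB _ _) _; rewrite lerD2r; exact: ler_normD.
Qed.

Lemma discrepancy_set0 T p : discrepancy T p set0 = 0.
Proof. by rewrite /discrepancy set0I /len measure0 mulr0 subrr normr0. Qed.

Lemma discrepancyU_disj T p V W : measurable T -> finlen V -> finlen W ->
  V `&` W = set0 ->
  discrepancy T p (V `|` W) <= discrepancy T p V + discrepancy T p W.
Proof.
move=> mT fV fW VW; apply: le_trans (discrepancyU _ mT fV fW) _.
by rewrite VW discrepancy_set0 addr0.
Qed.

(** The intervals may overlap, so inclusion-exclusion is applied one interval
    at a time: the bound doubles at each step, because the new interval cuts the
    earlier union into a union of as many intervals. This costs a factor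
    exponential in the number of intervals, which is bounded in the
    application. *)
Lemma discrepancy_bigsetU T p e n (F : nat -> set R) : measurable T ->
  (forall V, bounded_interval V -> discrepancy T p V <= e) ->
  (forall i, bounded_interval (F i)) ->
  finlen (\big[setU/set0]_(i < n) F i) /\
  discrepancy T p (\big[setU/set0]_(i < n) F i) <= (2 ^+ n - 1) * e.
Proof.
move=> mT de; elim: n F => [|n IH] F bF.
  by rewrite big_ord0 discrepancy_set0 expr0 subrr mul0r; split=> //; split; rewrite ?measure0.
have [fU dU] := IH _ bF.
have fF := bounded_interval_finlen (bF n).
rewrite big_ord_recr /=; split; first exact: finlenU.
apply: le_trans (discrepancyU _ mT fU fF) _.
have bF' i : bounded_interval (F n `&` F i).
  by apply: bounded_intervalI => //; case: (bF n).
have := proj2 (IH _ bF'); rewrite -big_distrr /= setIC => dI.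
have := de _ (bF n); rewrite exprS; lra.
Qed.

Lemma is_interval_affine u k V : 0 < u -> is_interval V ->
  is_interval ((fun y => u * y - k) @^-1` V).
Proof.
move=> u0 iV x y Vx Vy z /andP[xz zy]; apply: (iV _ _ Vx Vy).
by rewrite !lerD2r !ler_pM2l// xz.
Qed.

(** Within one period, the hit set is an affine copy of the union of
    intervals. *)
Lemma discrepancy_hitset_cell T p e u n (F : nat -> set R) (k : nat) :
  0 < u -> measurable T ->
  (forall V, bounded_interval V -> discrepancy T p V <= e) ->
  (forall i, is_interval (F i)) ->
  let V := hitset u (\big[setU/set0]_(i < n) F i) `&`
     `[k%:R / u, (k%:R + 1) / u[%classic `&` `[0, 1]%classic in
  finlen V /\ discrepancy T p V <= (2 ^+ n - 1) * e.
Proof.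
move=> u0 mT de iF V.
pose G i := (fun y => u * y - k%:R) @^-1` (F i `&` `[0, 1[%classic) `&` `[0, 1]%classic.
have -> : V = \big[setU/set0]_(i < n) G i.
  rewrite /V -[k%:R]/(k%:Z%:~R) hitset_cell//.
  rewrite -!bigcup_mkord setI_bigcupl preimage_bigcup setI_bigcupl.
  by [].
apply: discrepancy_bigsetU => // i; apply: bounded_intervalI; last first.
  split; [exact: interval_is_interval|by exists 0, 1].
apply: is_interval_affine => // x y [Fx x01] [Fy y01] z xzy.
split; first exact: (iF i x y).
exact: (@interval_is_interval _ `[0, 1[ x y).
Qed.

(** The interval [[0, 1]] meets at most [u + 1] periods. *)
Lemma discrepancy_hitset T p e u n (F : nat -> set R) :
  0 < u -> measurable T ->
  (forall V, bounded_interval V -> discrepancy T p V <= e) ->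
  (forall i, is_interval (F i)) ->
  discrepancy T p (hitset u (\big[setU/set0]_(i < n) F i) `&` `[0, 1]%classic)
    <= (u + 1) * ((2 ^+ n - 1) * e).
Proof.
move=> u0 mT de iF; set I := \big[_/_]_(_ < _) _.
have e0 : 0 <= e.
  apply: le_trans (de set0 _); first by rewrite discrepancy_set0.
  by split; [move=> ?|exists 0, 0].
have c0 : 0 <= (2 ^+ n - 1) * e.
  by rewrite mulr_ge0// subr_ge0 exprn_ege1// ler1n.
pose W (K : nat) := hitset u I `&` `[0, K%:R / u[%classic `&` `[0, 1]%classic.
have HW K : finlen (W K) /\ discrepancy T p (W K) <= K%:R * ((2 ^+ n - 1) * e).
  elim: K => [|K [fW dW]].
    rewrite /W mul0r set_itvco0 setI0 set0I discrepancy_set0 mul0r.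
    by split=> //; split; rewrite ?measure0.
  have [fV dV] := discrepancy_hitset_cell n K u0 mT de iF.
  have -> : W K.+1 = W K `|` (hitset u I `&` `[K%:R / u, (K%:R + 1) / u[%classic
      `&` `[0, 1]%classic).
    rewrite /W -setIUl -setIUr -natr1; congr (_ `&` _ `&` _).
    have h1 : 0 <= K%:R / u by rewrite divr_ge0// ltW.
    have h2 : K%:R / u <= (K%:R + 1) / u.
      by rewrite ler_pM2r ?invr_gt0// lerDl.
    apply/seteqP; split=> y /=; rewrite !in_itv/=.
      by case: (ltP y (K%:R / u)) => h /andP[h3 h4]; [left; rewrite h3|right].
    by move=> [] /andP[h3 h4]; apply/andP; split; lra.
  split; first exact: finlenU.
  apply: le_trans (discrepancyU_disj _ mT fW fV _) _.
    rewrite -subset0 => y [[[_ /=]]]; rewrite in_itv/= => /andP[_ h1] _ [[_ /=]].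
    rewrite in_itv/=; lra.
  by rewrite -natr1 [leRHS]mulrDl mul1r lerD.
have [K [K1 K2]] : exists K : nat, u < K%:R /\ K%:R <= u + 1.
  exists (Num.truncn u).+1; have /andP[h1 h2] := truncn_itv (ltW u0).
  by split=> //; rewrite -natr1 lerD2r.
have -> : hitset u I `&` `[0, 1]%classic = W K.
  rewrite /W -setIA; congr (_ `&` _); apply/esym/setIidPr => y /=.
  rewrite !in_itv/= => /andP[-> y1] /=; apply: le_lt_trans y1 _.
  by rewrite ltr_pdivlMr// mul1r.
apply: le_trans (proj2 (HW K)) _; exact: ler_wpM2r.
Qed.

End Unions.

(** * Correlation of two hit sets *)

Section Covariance.
Variable R : realType.
Implicit Types (I J : set R) (u v : R).

Lemma len_hitset_close v J : 0 < v -> measurable J -> J `<=` `[0, 1]%classic ->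
  `|len (hitset v J `&` `[0, 1]%classic) - len J| <= 2 * (len J / v).
Proof.
move=> v0 mJ J01; have := @discrepancy_interval R v J `[0, 1]%classic v0 mJ J01.
rewrite /discrepancy len_itv// subr0 mulr1 setIC; apply; first exact: interval_is_interval.
by exists 0, 1.
Qed.

Lemma union_of_intervals_measurable l I : union_of_intervals l I -> measurable I.
Proof.
by move=> [s [_ ->]]; apply: bigsetU_measurable => J _; exact: measurable_itv.
Qed.

(** Asymptotic independence: the hit set of [v] has density nearly [len J] in
    each of the [O(u)] intervals that make up the hit set of [u]. *)
Lemma hitset_cov u v I J (l : nat) : 0 < u -> 0 < v ->
  union_of_intervals l I ->
  measurable J -> J `<=` `[0, 1]%classic ->
  len (hitset u I `&` `[0, 1]%classic `&` hitset v J)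
  <= len J * len (hitset u I `&` `[0, 1]%classic)
     + (u + 1) * (2 ^+ l * (2 * (len J / v))).
Proof.
move=> u0 v0 [s [sl ->]] mJ J01.
have q0 : 0 <= 2 * (len J / v) by rewrite mulr_ge0// divr_ge0 ?len_ge0// ltW.
have dJ V : bounded_interval V -> discrepancy (hitset v J) (len J) V <= 2 * (len J / v).
  by move=> [iV bV]; exact: discrepancy_interval.
pose F i : set R := [set` nth `]0, 0[ s i].
have -> : \big[setU/set0]_(J <- s) [set` J] = \big[setU/set0]_(i < size s) F i.
  by rewrite (big_nth `]0, 0[) big_mkord.
have := @discrepancy_hitset R _ _ _ u (size s) F u0 (measurable_hitset v mJ) dJ.
have iF i : is_interval (F i) by exact: interval_is_interval.
move=> /(_ iF); rewrite ler_distl => /andP[_]; move/le_trans; apply.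
rewrite lerD2l ler_wpM2l ?addr_ge0 ?(ltW u0)// ler_wpM2r//.
apply: (@le_trans _ _ (2 ^+ size s)); first by rewrite gerDl lerN10.
by rewrite ler_weXn2l// ler1n.
Qed.

End Covariance.

(** * Means over the unit interval *)

Section Mean.
Variable R : realType.
Local Notation D := (`[0, 1]%classic : set R).
Implicit Types f g : R -> R.

Definition mean f : R := \int[mu]_(y in D) f y.

(** Bounded measurable functions are integrable on [[0, 1]] and closed under
    products, so that the second moment can be expanded freely. *)
Definition bmeas f :=
  measurable_fun D f /\ exists M : R, forall y, D y -> `|f y| <= M.

Lemma bmeas_integrable f : bmeas f -> mu.-integrable D (EFin \o f).
Proof.
move=> [mf [M fM]]; apply: measurable_bounded_integrable => //.
  by case: (finlen_itv true false (0:R) 1).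
exists M; split; first exact: num_real.
by move=> x Mx y Dy; apply: le_trans (fM _ Dy) _; exact: ltW.
Qed.

Lemma bmeasD f g : bmeas f -> bmeas g -> bmeas (fun y => f y + g y).
Proof.
move=> [mf [M fM]] [mg [M' gM]]; split; first exact: measurable_funD.
exists (M + M') => y Dy; apply: le_trans (ler_normD _ _) _.
by rewrite lerD ?fM ?gM.
Qed.

Lemma bmeasM f g : bmeas f -> bmeas g -> bmeas (fun y => f y * g y).
Proof.
move=> [mf [M fM]] [mg [M' gM]]; split; first exact: measurable_funM.
by exists (M * M') => y Dy; rewrite normrM ler_pM ?fM ?gM.
Qed.

Lemma bmeas_cst (c : R) : bmeas (fun=> c).
Proof. by split; [exact: measurable_cst|exists `|c|]. Qed.

Lemma bmeas_indic (T : set R) : measurable T -> bmeas \1_T.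
Proof.
move=> mT; split.
  by apply: measurable_funTS; exact: measurable_indic.
by exists 1 => y _; rewrite indicE; case: (_ \in _); rewrite ?normr1 ?normr0.
Qed.

Lemma bmeas_sum (f : nat -> R -> R) m n : (forall i, bmeas (f i)) ->
  bmeas (fun y => \sum_(m <= i < n) f i y).
Proof.
move=> bf; elim: n => [|n IH].
  have -> : (fun y => \sum_(m <= i < 0) f i y) = fun=> 0 :> R.
    by apply/funext => y; rewrite big_geq.
  exact: bmeas_cst.
have [mn|nm] := leqP m n.
  under eq_fun do rewrite big_nat_recr//=.
  exact: bmeasD.
have -> : (fun y => \sum_(m <= i < n.+1) f i y) = fun=> 0 :> R.
  by apply/funext => y; rewrite big_geq.
exact: bmeas_cst.
Qed.

Lemma meanD f g : bmeas f -> bmeas g ->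
  mean (fun y => f y + g y) = mean f + mean g.
Proof. by move=> bf bg; rewrite /mean RintegralD//; exact: bmeas_integrable. Qed.

Lemma meanZ c f : bmeas f -> mean (fun y => c * f y) = c * mean f.
Proof. by move=> bf; rewrite /mean RintegralZl//; exact: bmeas_integrable. Qed.

Lemma mean_cst c : mean (fun=> c) = c.
Proof.
by rewrite /mean Rintegral_cst// -/(len _) len_itv// subr0 mulr1.
Qed.

Lemma mean_indic (T : set R) : measurable T -> mean \1_T = len (T `&` D).
Proof. by move=> mT; rewrite /mean /Rintegral integral_indic. Qed.

Lemma le_mean f g : bmeas f -> bmeas g -> (forall y, D y -> f y <= g y) ->
  mean f <= mean g.
Proof. by move=> bf bg fg; apply: le_Rintegral => //; exact: bmeas_integrable. Qed.

Lemma mean_sum (f : nat -> R -> R) m n : (forall i, bmeas (f i)) ->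
  mean (fun y => \sum_(m <= i < n) f i y) = \sum_(m <= i < n) mean (f i).
Proof.
move=> bf; elim: n => [|n IH].
  rewrite big_geq// -[RHS]mean_cst; congr mean; apply/funext => y.
  by rewrite big_geq.
have [mn|nm] := leqP m n; last first.
  rewrite big_geq// -[RHS]mean_cst; congr mean; apply/funext => y.
  by rewrite big_geq.
rewrite big_nat_recr//= -IH -meanD//; last exact: bmeas_sum.
by congr mean; apply/funext => y; rewrite big_nat_recr.
Qed.

Lemma chebyshev_mean f t : bmeas f -> 0 < t ->
  len [set y | D y /\ t < `|f y|] <= mean (fun y => f y ^+ 2) / t ^+ 2.
Proof.
move=> bf t0.
have mF : measurable [set y | D y /\ t < `|f y|].
  rewrite [X in measurable X](_ : _ = D `&` (fun y => `|f y|) @^-1` `]t, +oo[).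
    have [mf _] := bf.
    have mn : measurable_fun D (fun y => `|f y|) by exact: measurableT_comp.
    exact: mn.
  by apply/seteqP; split=> y /=; rewrite !in_itv/= andbT.
rewrite ler_pdivlMr ?exprn_gt0// mulrC.
set F := [set _ | _] in mF *.
have -> : len F = mean \1_F.
  by rewrite mean_indic//; congr len; apply/esym/setIidPl => y [].
rewrite -meanZ; last exact: bmeas_indic.
apply: le_mean; [|under eq_fun do rewrite expr2; exact: bmeasM|].
  by apply: bmeasM; [exact: bmeas_cst|exact: bmeas_indic].
move=> y Dy; rewrite indicE; case: (boolP (y \in F)) => yF.
  move: yF; rewrite inE => -[_ tf]; rewrite mulr1 -[leRHS]real_normK ?num_real//.
  by rewrite lerXn2r// ?nnegrE ?ltW.
by rewrite mulr0 sqr_ge0.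
Qed.

End Mean.

(** * Second moment of the number of occurrences *)

Section SecondMoment.
Variables (R : realType) (E : nat -> set R) (p v : nat -> R) (A : set nat).
Variables (C K delta : R).
Hypothesis mE : forall n, measurable (E n).
Local Notation D := (`[0, 1]%classic : set R).

(** The set [A] of indices enters as 0-1 weights, so that sums range over
    intervals of integers and can be handled by induction on [N]. *)
Definition occurrences N (y : R) : R :=
  \sum_(1 <= n < N.+1) \1_A n * \1_(E n) y.
Definition expected_count N : R := \sum_(1 <= n < N.+1) \1_A n * p n.

Let Z n (y : R) : R := \1_A n * (\1_(E n) y - p n).
Let Q N (y : R) : R := \sum_(1 <= n < N.+1) Z n y.

Lemma occurrencesB N y : occurrences N y - expected_count N = Q N y.
Proof. by rewrite -sumrB; apply: eq_bigr => n _; rewrite /Z mulrBr. Qed.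

(** The mean of the product of the deviations of the two indicator functions
    from [p m] and [p n] (see [meanZZ]); these targets replace the exact means
    of the indicators. *)
Definition cov m n : R := len (E m `&` D `&` E n) - p n * len (E m `&` D)
  - p m * len (E n `&` D) + p m * p n.

Let bZ n : bmeas (Z n).
Proof.
apply: bmeasM; first exact: bmeas_cst.
by apply: bmeasD; [exact: bmeas_indic|exact: bmeas_cst].
Qed.

Let meanZZ m n : mean (fun y => Z m y * Z n y) = \1_A m * \1_A n * cov m n.
Proof.
have b1 : bmeas \1_(E m `&` E n).
  by apply: bmeas_indic; exact: measurableI.
have b2 : bmeas \1_(E m) by exact: bmeas_indic.
have b3 : bmeas \1_(E n) by exact: bmeas_indic.
have bz (c : R) f : bmeas f -> bmeas (fun y => c * f y).
  by move=> ?; apply: bmeasM => //; exact: bmeas_cst.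
transitivity (mean (fun y => \1_A m * \1_A n *
   (\1_(E m `&` E n) y + ((- p n) * \1_(E m) y + ((- p m) * \1_(E n) y
     + p m * p n))))).
  by congr mean; apply/funext => y; rewrite indicI /Z /=; ring.
rewrite meanZ ?meanD ?meanZ ?mean_indic ?mean_cst//;
  do ?[exact: measurableI | exact: bmeas_cst | exact: bz | apply: bmeasD => //].
rewrite /cov setIAC; ring.
Qed.

Hypothesis p_ge0 : forall n, (0 < n)%N -> 0 <= p n.
Hypothesis v_gt0 : forall n, (0 < n)%N -> 0 < v n.
Hypothesis C_ge0 : 0 <= C.
Hypothesis covC : forall m n, (0 < m <= n)%N ->
  cov m n <= C * (p n * (v m / v n)).
Hypothesis vK : forall n, (0 < n)%N ->
  \sum_(1 <= m < n.+1) v m / v n <= K * n%:R `^ delta.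

Lemma expected_count_ge0 N : 0 <= expected_count N.
Proof.
rewrite /expected_count big_nat_cond; apply: sumr_ge0 => n /andP[/andP[n0 _] _].
by rewrite mulr_ge0 ?p_ge0.
Qed.

(** Adding the term of index [N.+1] to the sum adds, to the second moment,
    twice its correlations with the earlier terms and its own square. All of
    these are dominated by multiples of [v m / v N.+1], whose sum over [m] is
    [O(N.+1 ^ delta)]. *)
Lemma second_moment N :
  mean (fun y => Q N y ^+ 2) <=
  2 * C * K * \sum_(1 <= n < N.+1) \1_A n * p n * n%:R `^ delta.
Proof.
elim: N => [|N IH].
  rewrite big_geq// mulr0 /Q.
  under eq_fun do rewrite big_geq// expr0n.
  by rewrite mean_cst.
have bQ n : bmeas (Q n) by exact: bmeas_sum.
have -> : mean (fun y => Q N.+1 y ^+ 2) = mean (fun y => Q N y ^+ 2) +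
   (2 * mean (fun y => Q N y * Z N.+1 y) + mean (fun y => Z N.+1 y * Z N.+1 y)).
  have b1 : bmeas (fun y => Q N y * Z N.+1 y) by exact: bmeasM.
  have b2 : bmeas (fun y => 2 * (Q N y * Z N.+1 y)).
    by apply: bmeasM => //; exact: bmeas_cst.
  have b3 : bmeas (fun y => Z N.+1 y * Z N.+1 y) by exact: bmeasM.
  have b4 : bmeas (fun y => Q N y ^+ 2).
    by under eq_fun do rewrite expr2; exact: bmeasM.
  rewrite -meanZ// -(meanD b2 b3) -meanD//; last exact: bmeasD.
  congr mean; apply/funext => y; rewrite /Q big_nat_recr//= -/(Q N y); ring.
have -> : mean (fun y => Q N y * Z N.+1 y) =
    \sum_(1 <= m < N.+1) \1_A m * \1_A N.+1 * cov m N.+1.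
  rewrite /Q; under eq_fun do rewrite mulr_suml.
  rewrite mean_sum; last by move=> i; exact: bmeasM.
  by apply: eq_bigr => m _; rewrite meanZZ.
rewrite meanZZ [in leRHS]big_nat_recr//= [leRHS]mulrDr; apply: lerD => //.
have a01 n : 0 <= (\1_A n : R) <= 1.
  by rewrite indicE; case: (_ \in _); rewrite ?ler01 ?lexx.
have cw m : (0 < m <= N.+1)%N -> \1_A m * \1_A N.+1 * cov m N.+1 <=
    \1_A N.+1 * p N.+1 * C * (v m / v N.+1).
  move=> /[dup] hm /andP[m0 _].
  have b0 : 0 <= C * (p N.+1 * (v m / v N.+1)).
    by rewrite !mulr_ge0 ?p_ge0// ?invr_ge0 ltW// v_gt0.
  have /andP[am0 am1] := a01 m; have /andP[aN0 _] := a01 N.+1.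
  apply: (@le_trans _ _ (\1_A m * \1_A N.+1 * (C * (p N.+1 * (v m / v N.+1))))).
    by apply: ler_wpM2l; [exact: mulr_ge0|exact: covC].
  apply: (@le_trans _ _ (1 * \1_A N.+1 * (C * (p N.+1 * (v m / v N.+1))))).
    by rewrite ler_wpM2r// ler_wpM2r.
  by rewrite mul1r; rewrite le_eqVlt; apply/orP; left; apply/eqP; ring.
have h1 : \sum_(1 <= m < N.+1) \1_A m * \1_A N.+1 * cov m N.+1 <=
    \1_A N.+1 * p N.+1 * C * \sum_(1 <= m < N.+1) v m / v N.+1.
  rewrite mulr_sumr; apply: ler_sum_nat => m /andP[m0 mN].
  by apply: cw; rewrite m0 ltnW.
have h2 := cw N.+1 (leqnn _).
have h2' : 0 <= \1_A N.+1 * p N.+1 * C * (v N.+1 / v N.+1).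
  by rewrite !mulr_ge0 ?p_ge0// ?invr_ge0 ltW// v_gt0.
have h3 := vK (isT : (0 < N.+1)%N).
rewrite big_nat_recr//= in h3.
have h4 : \1_A N.+1 * p N.+1 * C * (\sum_(1 <= m < N.+1) v m / v N.+1
   + v N.+1 / v N.+1) <= \1_A N.+1 * p N.+1 * C * (K * N.+1%:R `^ delta).
  by apply: ler_wpM2l => //; rewrite !mulr_ge0 ?p_ge0.
have -> : 2 * C * K * (\1_A N.+1 * p N.+1 * N.+1%:R `^ delta) =
  2 * (\1_A N.+1 * p N.+1 * C * (K * N.+1%:R `^ delta)) by ring.
rewrite mulrDr in h4; lra.
Qed.

Hypothesis delta_ge0 : 0 <= delta.
Hypothesis K_ge0 : 0 <= K.

(** Chebyshev's inequality, with [n ^ delta <= N ^ delta] in the bound for the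
    second moment. *)
Lemma deviation N t : 0 < t ->
  len [set y | D y /\ t < `|occurrences N y - expected_count N|] <=
  2 * C * K * (N%:R `^ delta * expected_count N) / t ^+ 2.
Proof.
move=> t0; under eq_set do rewrite occurrencesB.
apply: le_trans (chebyshev_mean _ t0) _; first exact: bmeas_sum.
rewrite ler_wpM2r ?invr_ge0 ?exprn_ge0 ?(ltW t0)//.
apply: le_trans (second_moment N) _.
rewrite ler_wpM2l ?mulr_ge0// /expected_count mulr_sumr.
apply: ler_sum_nat => n /andP[n0 nN].
rewrite mulrC ler_wpM2r ?mulr_ge0 ?p_ge0//.
by rewrite ge0_ler_powR// ?nnegrE// ler_nat.
Qed.

End SecondMoment.

(** * Almost every point of the unit interval *)

Section BorelCantelli.
Variable R : realType.
Local Notation D := (`[0, 1]%classic : set R).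

(** The almost-everywhere filter lives on the carrier of the Borel
    sigma-algebra, where instance search does not find it from [R]. *)
Lemma ae01_filter : Filter (almost_everywhere (@lebesgue_measure R)).
Proof. exact: (@ae_filter_ringOfSetsType _ _ _ (@lebesgue_measure R)). Qed.

Lemma ae01_sub (P Q : R -> Prop) : (forall y, y \in `[0, 1] -> P y -> Q y) ->
  ae01 P -> ae01 Q.
Proof.
rewrite /ae01 => PQ; apply: (@filterS _ _ ae01_filter) => y Py y01.
by apply: PQ => //; exact: Py.
Qed.

Lemma ae01_and (P Q : R -> Prop) :
  ae01 P -> ae01 Q -> ae01 (fun y => P y /\ Q y).
Proof.
rewrite /ae01; apply: (@filterS2 _ _ ae01_filter) => y Py Qy y01.
by split; [exact: Py|exact: Qy].
Qed.

Lemma ae01_forall (P : nat -> R -> Prop) :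
  (forall n, ae01 (P n)) -> ae01 (fun y => forall n, P n y).
Proof.
rewrite /ae01 => aP; have := @ae_foralln _ _ _ (@lebesgue_measure R) _ aP.
by apply: (@filterS _ _ ae01_filter) => y Py y01 n; exact: Py.
Qed.

Lemma borel_cantelli01 (B : nat -> set R) (c : R) :
  (forall k, measurable (B k)) -> (forall k, B k `<=` D) ->
  (forall n, \sum_(k < n) len (B k) <= c) ->
  ae01 (fun y => exists k0, forall k, (k0 <= k)%N -> ~ B k y).
Proof.
move=> mB BD Bc.
have fB k : finlen (B k) := finlenS (mB k) (BD k) (finlen_itv _ _ _ _).
have L0 : mu (lim_sup_set B) = 0%E.
  apply: (@lim_sup_set_cvg0 _ _ _ (@lebesgue_measure R)) => //.
  apply: (@le_lt_trans _ _ c%:E); last exact: ltry.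
  apply: lime_le; first exact: is_cvg_nneseries.
  apply: nearW => n /=; rewrite big_mkord.
  under eq_bigr do rewrite lenE//.
  by rewrite sumEFin lee_fin.
exists (lim_sup_set B); split=> //.
  by apply: bigcapT_measurable => n; apply: bigcup_measurable => k _; exact: mB.
move=> y /= ny n _; apply: contrapT => nB; apply: ny => _.
exists n => k nk Bk; apply: nB; by exists k.
Qed.

End BorelCantelli.

(** * Counting functions *)

Section Counting.
Variable R : realType.

Lemma counting_fun0 (A : set nat) : counting_fun A 0 = 0%N.
Proof.
rewrite /counting_fun (_ : _ `&` _ = set0) ?fset_set0//.
by rewrite -subset0 => n [_ /=] /andP[n1 n0]; have := leq_trans n1 n0.
Qed.

Lemma counting_funS (A : set nat) N :
  counting_fun A N.+1 = (counting_fun A N + (N.+1 \in A))%N.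
Proof.
have fin M : finite_set (A `&` [set n | (1 <= n <= M)%N]).
  apply: (@sub_finite_set _ _ `I_M.+1); last exact: finite_II.
  by move=> n [_ /=] /andP[_]; rewrite ltnS.
rewrite /counting_fun; case: (boolP (N.+1 \in A)) => NA.
  have -> : A `&` [set n | (1 <= n <= N.+1)%N] =
      N.+1 |` (A `&` [set n | (1 <= n <= N)%N]).
    apply/seteqP; split=> n /=.
      move=> [An /andP[n1]]; rewrite leq_eqVlt => /predU1P[->|nN]; [by left|].
      by right; split=> //; rewrite n1 -ltnS.
    move=> [->|[An /andP[n1 nN]]]; first by split; [exact: set_mem|rewrite leqnn].
    by rewrite n1 leqW.
  rewrite fset_setU1// cardfsU1 in_fset_set// addnC; congr addn.
  suff -> : N.+1 \notin (A `&` [set n | (1 <= n <= N)%N]) by [].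
  by apply/negP => /set_mem[_ /=]; rewrite ltnn.
rewrite addn0; congr (#|` fset_set _|)%fset; apply/seteqP; split=> n /= [An].
  move=> /andP[n1]; rewrite leq_eqVlt => /predU1P[nN|nN].
    by move: NA; rewrite -nN => /negP; case; exact/mem_set.
  by split=> //; rewrite n1 -ltnS.
by move=> /andP[n1 nN]; rewrite n1 leqW.
Qed.

Lemma counting_funE (A : set nat) N :
  (counting_fun A N)%:R = \sum_(1 <= n < N.+1) \1_A n :> R.
Proof.
elim: N => [|N IH]; first by rewrite big_geq// counting_fun0.
by rewrite counting_funS natrD IH [RHS]big_nat_recr// indicE.
Qed.

Lemma leq_counting_fun (A : set nat) m n : (m <= n)%N ->
  (counting_fun A m <= counting_fun A n)%N.
Proof.
move=> /subnK <-; elim: (n - m)%N => //= d IH.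
by rewrite addSn counting_funS (leq_trans IH)// leq_addr.
Qed.

Lemma counting_fun_leq (A : set nat) N : (counting_fun A N <= N)%N.
Proof.
elim: N => [|N IH]; first by rewrite counting_fun0.
by rewrite counting_funS -addn1 leq_add// leq_b1.
Qed.

Lemma counting_fun_posnats N : counting_fun posnats N = N.
Proof.
elim: N => [|N IH]; first by rewrite counting_fun0.
by rewrite counting_funS IH mem_set// addn1.
Qed.

End Counting.

(** * Sublacunary sequences *)

Section Sublacunary.
Variables (R : realType) (delta : R) (u : nat -> R).
Hypothesis delta_ge0 : 0 <= delta.

Lemma sublacunary_ge : sublacunary delta u ->
  forall n, (0 < n)%N -> u 1%N <= u n.
Proof.
move=> [_ u0 [c [c0 c1 hc]]]; elim=> // -[//|n] IH _.
apply: le_trans (IH isT) _; have := hc n.+1 isT.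
rewrite ler_pdivlMr ?u0// => h; apply: le_trans h.
by rewrite ler_peMl ?lerDl ?mulr_ge0 ?powR_ge0// ltW// u0.
Qed.

(** The sum [r n] on the left satisfies
    [r n.+1 = 1 + r n * (u n / u n.+1) <= 1 + r n / (1 + c * n ^ (- delta))],
    and [K * n ^ delta] is a supersolution of this recursion for
    [K = (1 + c) / c]. *)
Lemma sublacunary_sum : sublacunary delta u -> exists K : R, 0 <= K /\
  forall n, (0 < n)%N -> \sum_(1 <= m < n.+1) u m / u n <= K * n%:R `^ delta.
Proof.
move=> [_ u0 [c [c0 c1 hc]]].
have c0' := ltW c0.
pose K := (1 + c) / c; have K1 : 1 <= K by rewrite ler_pdivlMr//; lra.
exists K; split; first lra.
elim=> // -[_ _|n IH _].
  by rewrite big_nat1 powR1 mulr1 divff// gt_eqF// u0.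
rewrite big_nat_recr//= divff ?gt_eqF ?u0//.
have un : 0 < u n.+1 by exact: u0.
have -> : \sum_(1 <= m < n.+2) u m / u n.+2 =
   (\sum_(1 <= m < n.+2) u m / u n.+1) * (u n.+1 / u n.+2).
  rewrite mulr_suml; apply: eq_bigr => m _.
  by field; rewrite !gt_eqF ?u0.
set x : R := n.+1%:R `^ delta.
have x0 : 0 < x by rewrite powR_gt0.
have x1 : 1 <= x.
  have := @ger1_powR R; have := @ler_powR R n.+1%:R.
  rewrite ler1n => /(_ isT) h _; have := h _ _ delta_ge0.
  by rewrite powRr0.
have hcn := hc n.+1 isT; rewrite powRN -/x in hcn.
have cx0 : 0 < c / x by rewrite divr_gt0.
have r1 : u n.+1 / u n.+2 <= (1 + c / x)^-1.
  rewrite -invf_div lef_pV2 ?posrE ?addr_gt0// divr_gt0// u0//.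
have r0 : 0 <= u n.+1 / u n.+2 by rewrite divr_ge0// ltW// u0.
apply: (@le_trans _ _ (K * x * (1 + c / x)^-1 + 1)).
  rewrite lerD2r; apply: le_trans (_ : _ <= K * x * (u n.+1 / u n.+2)) _.
    by apply: ler_wpM2r => //; exact: IH.
  by apply: ler_wpM2l => //; rewrite mulr_ge0//; lra.
apply: (@le_trans _ _ (K * x)); last first.
  apply: ler_wpM2l; first lra.
  by rewrite /x ge0_ler_powR// ?nnegrE// ler_nat.
(* This is where the value of K matters: K * c = 1 + c exceeds 1 + c / x. *)
rewrite -lerBrDr ler_pdivrMr ?addr_gt0//.
have -> : (K * x - 1) * (1 + c / x) = K * x + (K * c - 1 - c / x).
  by field; rewrite gt_eqF.
rewrite lerDl.
have -> : K * c = 1 + c by rewrite /K divfK// gt_eqF.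
have : c / x <= c by rewrite ler_pdivrMr// ler_peMr.
lra.
Qed.

End Sublacunary.

(** * Limits inferior and superior of sequences in the unit interval *)

Section LimSup.
Variable R : realType.
Implicit Types (u : nat -> R) (g : R).

Definition unit_seq u := forall n, 0 <= u n <= 1.

Lemma unit_seq_bounded u : unit_seq u -> bounded_fun u.
Proof.
move=> u01; exists 1; split=> // x x1 n _.
by have /andP[u0 u1] := u01 n; rewrite /= ger0_norm// (le_trans u1)// ltW.
Qed.

Lemma limn_sup_le u g : unit_seq u ->
  (exists N0, forall n, (N0 <= n)%N -> u n <= g) -> limn_sup u <= g.
Proof.
move=> u01 [N0 ug]; rewrite limn_supE; last exact: unit_seq_bounded.
apply: (@le_trans _ _ (sups u N0)).
  apply: ge_inf; last by exists N0.
  exact/bounded_fun_has_lbound_sups/unit_seq_bounded.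
apply: ge_sup; first by exists (u N0), N0 => /=.
by move=> _ [n /= N0n <-]; exact: ug.
Qed.

Lemma limn_sup_ge u g : unit_seq u ->
  (forall N0, exists n, (N0 <= n)%N /\ g <= u n) -> g <= limn_sup u.
Proof.
move=> u01 ug; rewrite limn_supE; last exact: unit_seq_bounded.
apply: lb_le_inf; first by exists (sups u 0), 0%N.
move=> _ [N0 _ <-]; have [n [N0n gu]] := ug N0.
apply: le_trans gu _; apply: ub_le_sup; last by exists n.
exact/has_ubound_sdrop/bounded_fun_has_ubound/unit_seq_bounded.
Qed.

Lemma limn_inf_ge u g : unit_seq u ->
  (exists N0, forall n, (N0 <= n)%N -> g <= u n) -> g <= limn_inf u.
Proof.
move=> u01 [N0 ug]; rewrite limn_infE; last exact: unit_seq_bounded.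
apply: (@le_trans _ _ (infs u N0)); last first.
  apply: ub_le_sup; last by exists N0.
  exact/bounded_fun_has_ubound_infs/unit_seq_bounded.
apply: lb_le_inf; first by exists (u N0), N0 => /=.
by move=> _ [n /= N0n <-]; exact: ug.
Qed.

Lemma limn_inf_le u g : unit_seq u ->
  (forall N0, exists n, (N0 <= n)%N /\ u n <= g) -> limn_inf u <= g.
Proof.
move=> u01 ug; rewrite limn_infE; last exact: unit_seq_bounded.
apply: ge_sup; first by exists (infs u 0), 0%N.
move=> _ [N0 _ <-]; have [n [N0n gu]] := ug N0.
apply: le_trans gu; apply: ge_inf; last by exists n.
exact/has_lbound_sdrop/bounded_fun_has_lbound/unit_seq_bounded.
Qed.

Lemma limn_sup_lt u g : unit_seq u -> limn_sup u < g ->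
  exists N0, forall n, (N0 <= n)%N -> u n < g.
Proof.
move=> u01; apply: contraPP => nu; apply/negP; rewrite -leNgt.
apply: limn_sup_ge => // N0; apply: contrapT => nN; apply: nu; exists N0 => n N0n.
by rewrite ltNge; apply/negP => gu; apply: nN; exists n.
Qed.

Lemma lt_limn_sup u g : unit_seq u -> g < limn_sup u ->
  forall N0, exists n, (N0 <= n)%N /\ g < u n.
Proof.
move=> u01 + N0; apply: contraPP => nu; apply/negP; rewrite -leNgt.
apply: limn_sup_le => //; exists N0 => n N0n; rewrite leNgt; apply/negP => gu.
by apply: nu; exists n.
Qed.

Lemma lt_limn_inf u g : unit_seq u -> g < limn_inf u ->
  exists N0, forall n, (N0 <= n)%N -> g < u n.
Proof.
move=> u01; apply: contraPP => nu; apply/negP; rewrite -leNgt.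
apply: limn_inf_le => // N0; apply: contrapT => nN; apply: nu; exists N0 => n N0n.
by rewrite ltNge; apply/negP => gu; apply: nN; exists n.
Qed.

Lemma limn_inf_le_sup u : unit_seq u -> limn_inf u <= limn_sup u.
Proof.
move=> u01; apply/ler_addgt0Pr => e e0.
have [|N0 uN] := @limn_sup_lt u (limn_sup u + e) u01; first by rewrite ltrDl.
apply: limn_inf_le => // N1; exists (maxn N0 N1); split; first exact: leq_maxr.
by rewrite ltW// uN// leq_maxl.
Qed.

End LimSup.

(** * Mass dimensions and powers of N *)

Section MassDimension.
Variable R : realType.
Implicit Types (A : set nat) (c g k : R).
Local Notation count A N := ((counting_fun A N)%:R : R).

Lemma mdim_seq_unit A : unit_seq (@mdim_seq R A).
Proof.
move=> N; rewrite /mdim_seq.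
have [->|c0] := posnP (counting_fun A N).
  by rewrite ln0// mul0r lexx ler01.
have cN := counting_fun_leq A N.
have [N1|N1] := leqP N 1.
  have -> : N = 1%N by apply/eqP; rewrite eqn_leq N1 (leq_trans c0).
  by rewrite ln1 invr0 mulr0 lexx ler01.
have lN : 0 < ln (N%:R : R) by rewrite ln_gt0// ltr1n.
have lc : 0 <= ln (count A N) by rewrite ln_ge0// ler1n.
rewrite divr_ge0 ?(ltW lN)//= ler_pdivrMr// mul1r ler_ln ?posrE ?ltr0n ?ler_nat//.
by rewrite ltnW.
Qed.

Lemma lower_mdim_le_upper A : lower_mdim R A <= upper_mdim R A.
Proof. exact/limn_inf_le_sup/mdim_seq_unit. Qed.

Lemma lower_mdim_ge0 A : 0 <= lower_mdim R A.
Proof.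
apply: limn_inf_ge; first exact: mdim_seq_unit.
by exists 0%N => n _; have /andP[] := mdim_seq_unit A n.
Qed.

Lemma upper_mdim_le1 A : upper_mdim R A <= 1.
Proof.
apply: limn_sup_le; first exact: mdim_seq_unit.
by exists 0%N => n _; have /andP[] := mdim_seq_unit A n.
Qed.

Lemma powR_large k c : 0 < k ->
  exists N0, forall N, (N0 <= N)%N -> c <= N%:R `^ k.
Proof.
move=> k0; pose x := Num.max c 0 `^ k^-1.
exists (Num.truncn x).+1 => N xN.
have xN' : x <= N%:R.
  by apply: ltW; apply: lt_le_trans (truncnS_gt x) _; rewrite ler_nat.
have xE : x `^ k = Num.max c 0.
  by rewrite /x -powRrM mulVf ?gt_eqF// powRr1// le_max lexx orbT.
apply: (@le_trans _ _ (Num.max c 0)); first by rewrite le_max lexx.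
by rewrite -xE ge0_ler_powR ?nnegrE ?powR_ge0// ltW.
Qed.

Lemma mdim_seq_le A k N : 0 <= k -> (1 < N)%N ->
  (mdim_seq R A N <= k) = (count A N <= N%:R `^ k).
Proof.
move=> k0 N1; have lN : 0 < ln (N%:R : R) by rewrite ln_gt0// ltr1n.
rewrite /mdim_seq ler_pdivrMr//.
have [->|c0] := posnP (counting_fun A N).
  by rewrite ln0// mulr_ge0 ?(ltW lN)// powR_ge0.
by rewrite -ln_powR ler_ln// posrE ?ltr0n// powR_gt0// ltr0n ltnW.
Qed.

Lemma le_mdim_seq A k N : (1 < N)%N -> (0 < counting_fun A N)%N ->
  (k <= mdim_seq R A N) = (N%:R `^ k <= count A N).
Proof.
move=> N1 c0; have lN : 0 < ln (N%:R : R) by rewrite ln_gt0// ltr1n.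
rewrite /mdim_seq ler_pdivlMr// -ln_powR ler_ln// posrE ?ltr0n//.
by rewrite powR_gt0// ltr0n ltnW.
Qed.

(** A constant factor does not affect the dimension, as [c <= N ^ e]
    eventually for every [e > 0]. *)
Lemma upper_mdim_le A c k : 0 <= k ->
  (exists N0, forall N, (N0 <= N)%N -> count A N <= c * N%:R `^ k) ->
  upper_mdim R A <= k.
Proof.
move=> k0 [N0 cN]; apply/ler_addgt0Pr => e e0.
have [N1 eN] := @powR_large e c e0.
apply: limn_sup_le; first exact: mdim_seq_unit.
exists (maxn 2 (maxn N0 N1)) => N; rewrite !geq_max => /and3P[N2 h0 h1].
rewrite mdim_seq_le ?addr_ge0 ?(ltW e0)//; apply: le_trans (cN _ h0) _.
rewrite powRD; last by rewrite pnatr_eq0 -lt0n ltnW// implybT.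
by rewrite mulrC ler_wpM2l ?powR_ge0// eN.
Qed.

(** Lowering an exponent absorbs a constant factor; the bounds [N1 <= N] and
    [1 < N] come along for the uses below. *)
Lemma powR_small e c N1 : 0 < e -> 0 < c -> exists N0, forall N k, (N0 <= N)%N ->
  (N1 <= N)%N /\ (1 < N)%N /\ N%:R `^ (k - e) <= c * N%:R `^ k.
Proof.
move=> e0 c0; have [N0 eN] := @powR_large e c^-1 e0.
exists (maxn 2 (maxn N0 N1)) => N k; rewrite !geq_max => /and3P[N2 h0 h1].
split=> //; split=> //.
rewrite powRB; last by rewrite pnatr_eq0 -lt0n ltnW// implybT.
rewrite mulrC ler_wpM2r ?powR_ge0// -[leRHS]invrK lef_pV2 ?posrE ?invr_gt0//.
  exact: eN.
by rewrite powR_gt0// ltr0n ltnW.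
Qed.

Lemma upper_mdim_ge A c k : 0 < c ->
  (forall N0, exists N, (N0 <= N)%N /\ c * N%:R `^ k <= count A N) ->
  k <= upper_mdim R A.
Proof.
move=> c0 cN; apply/ler_addgt0Pr => e e0.
rewrite -lerBlDr; apply: limn_sup_ge; first exact: mdim_seq_unit.
move=> N1; have [N0 eN] := powR_small N1 e0 c0.
have [N [N0N kN]] := cN N0; exists N; have [N1N [N2 h]] := eN _ k N0N.
split=> //; rewrite le_mdim_seq ?(le_trans h)//.
rewrite -(ltr_nat R); apply: lt_le_trans kN.
by rewrite mulr_gt0// powR_gt0// ltr0n ltnW.
Qed.

Lemma lower_mdim_ge A c k : 0 < c ->
  (exists N0, forall N, (N0 <= N)%N -> c * N%:R `^ k <= count A N) ->
  k <= lower_mdim R A.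
Proof.
move=> c0 [N1 cN]; apply/ler_addgt0Pr => e e0.
rewrite -lerBlDr; apply: limn_inf_ge; first exact: mdim_seq_unit.
have [N0 eN] := powR_small N1 e0 c0.
exists N0 => N N0N; have [N1N [N2 h]] := eN _ k N0N.
have kN := cN _ N1N; rewrite le_mdim_seq ?(le_trans h)//.
rewrite -(ltr_nat R); apply: lt_le_trans kN.
by rewrite mulr_gt0// powR_gt0// ltr0n ltnW.
Qed.

Lemma upper_mdim_lt A k : upper_mdim R A < k ->
  exists c, forall N, (0 < N)%N -> count A N <= c * N%:R `^ k.
Proof.
move=> Ak; have k0 : 0 <= k.
  apply: ltW; apply: le_lt_trans Ak.
  exact: le_trans (lower_mdim_ge0 A) (lower_mdim_le_upper A).
have [N0 kN] := limn_sup_lt (mdim_seq_unit A) Ak.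
(* Below the threshold from which N ^ k is a bound, the trivial bound by N is
   absorbed by the constant. *)
exists (maxn 1 (maxn N0 2))%:R => N N0'.
have pk : 1 <= N%:R `^ k :> R.
  have := @ler_powR R N%:R; rewrite ler1n => /(_ N0') h; have := h _ _ k0.
  by rewrite powRr0.
have [|hN] := leqP (maxn N0 2) N.
  rewrite geq_max => /andP[h0 h2]; have := ltW (kN _ h0).
  rewrite mdim_seq_le// => h; apply: le_trans h _.
  by rewrite ler_peMl ?powR_ge0// ler1n leq_maxl.
apply: (@le_trans _ _ N%:R); first by rewrite ler_nat counting_fun_leq.
rewrite -[leLHS]mulr1 ler_pM// ler_nat.
by rewrite leq_max (ltnW hN) orbT.
Qed.

Lemma lt_upper_mdim A k : 0 <= k -> k < upper_mdim R A ->
  forall N0, exists N, (N0 <= N)%N /\ N%:R `^ k <= count A N.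
Proof.
move=> k0 kA N0; have [N [hN kN]] := lt_limn_sup (mdim_seq_unit A) kA (maxn 2 N0).
move: hN; rewrite geq_max => /andP[N2 N0N]; exists N; split=> //.
by move: kN; rewrite ltNge mdim_seq_le// -ltNge => /ltW.
Qed.

Lemma lt_lower_mdim A k : 0 <= k -> k < lower_mdim R A ->
  exists N0, forall N, (N0 <= N)%N -> N%:R `^ k <= count A N.
Proof.
move=> k0 kA; have [N0 kN] := lt_limn_inf (mdim_seq_unit A) kA.
exists (maxn 2 N0) => N; rewrite geq_max => /andP[N2 N0N].
by have := kN _ N0N; rewrite ltNge mdim_seq_le// -ltNge => /ltW.
Qed.

End MassDimension.

(** * Elementary sums and powers *)

Section Auxiliary.
Variable R : realType.
Implicit Types (x y c : R).

Lemma le_addinv x y c : 0 <= c -> (forall j : nat, x <= y + c / j.+1%:R) -> x <= y.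
Proof.
move=> c0 xy; apply/ler_addgt0Pr => e e0.
pose j := Num.truncn (c / e).
apply: le_trans (xy j) _; rewrite lerD2l ler_pdivrMr// mulrC -ler_pdivrMr//.
by rewrite ltW// truncnS_gt.
Qed.

Lemma geometric_sum_le x n : 0 <= x -> x < 1 ->
  \sum_(k < n) x ^+ k <= (1 - x)^-1.
Proof.
move=> x0 x1; have x1' : 0 < 1 - x by rewrite subr_gt0.
suff H : (1 - x) * \sum_(k < n) x ^+ k = 1 - x ^+ n.
  by rewrite -[leRHS]mul1r ler_pdivlMr// mulrC H gerBl exprn_ge0.
elim: n => [|n IH]; first by rewrite big_ord0 mulr0 expr0 subrr.
rewrite big_ord_recr/= mulrDr IH exprS; ring.
Qed.

Lemma inverse_square_sum_le n : \sum_(k < n) (k.+1%:R ^- 2) <= 2 :> R.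
Proof.
suff H : \sum_(k < n) (k.+1%:R ^- 2) <= 2 * (1 - n.+1%:R^-1) :> R.
  by apply: le_trans H _; rewrite ler_piMr// gerBl invr_ge0.
elim: n => [|n IH]; first by rewrite big_ord0 invr1 subrr mulr0.
rewrite big_ord_recr/=; apply: le_trans (lerD IH (lexx _)) _.
have n0 : 0 <= n%:R :> R by [].
have -> : (n.+2%:R : R) = n%:R + 2 by rewrite -addn2 natrD.
have -> : (n.+1%:R : R) = n%:R + 1 by rewrite natr1.
set z : R := n%:R in n0 *.
rewrite -subr_ge0.
have -> : 2 * (1 - (z + 2)^-1) - (2 * (1 - (z + 1)^-1) + (z + 1) ^- 2) =
  z / ((z + 2) * (z + 1) ^+ 2).
  by field; apply/andP; split; lra.
by rewrite divr_ge0// mulr_ge0 ?sqr_ge0//; lra.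
Qed.

(** The graph of a concave power lies below its tangents; after scaling to
    [x = 1] this is Young's inequality for [t ^ s * 1]. *)
Lemma powR_tangent x y s : 0 < s -> s < 1 -> 0 < x -> 0 <= y ->
  y `^ s <= x `^ s + s * x `^ (s - 1) * (y - x).
Proof.
move=> s0 s1 x0 y0.
have Bernoulli t : 0 <= t -> t `^ s <= s * t + (1 - s).
  move=> t0; have s1' : 0 < 1 - s by lra.
  have := @conjugate_powR R (t `^ s) 1 s^-1 (1 - s)^-1 (powR_ge0 _ _) ler01.
  rewrite !invr_gt0 !invrK => /(_ s0 s1') H.
  have : s + (1 - s) = 1 by ring.
  move=> /H; rewrite mulr1 -powRrM mulfV ?gt_eqF// powRr1// powR1.
  by rewrite mul1r mulrC.
have yE : y = x * (y / x) by rewrite mulrC divfK// gt_eqF.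
rewrite {1}yE powRM ?divr_ge0 ?(ltW x0)//.
apply: (@le_trans _ _ (x `^ s * (s * (y / x) + (1 - s)))).
  by apply: ler_wpM2l; rewrite ?powR_ge0// Bernoulli// divr_ge0 ?(ltW x0).
rewrite le_eqVlt; apply/orP; left; apply/eqP.
have -> : x `^ s = x * x `^ (s - 1) by rewrite mulr_powRB1// ltW.
by field; rewrite gt_eqF.
Qed.

Lemma natr_powR_gt0 n x : (0 < n)%N -> 0 < (n%:R : R) `^ x.
Proof. by move=> n0; rewrite powR_gt0// ltr0n. Qed.

Lemma natr_powRD n x y : (0 < n)%N ->
  (n%:R : R) `^ (x + y) = n%:R `^ x * n%:R `^ y.
Proof. by move=> n0; rewrite powRD// pnatr_eq0 -lt0n n0 implybT. Qed.

Lemma ler_nat_powR m n x : 0 <= x -> (m <= n)%N ->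
  (m%:R : R) `^ x <= n%:R `^ x.
Proof. by move=> x0 mn; rewrite ge0_ler_powR// ?nnegrE// ler_nat. Qed.

Lemma natrX_powR m k x : ((m ^ k)%:R : R) `^ x = (m%:R `^ x) ^+ k.
Proof.
elim: k => [|k IH]; first by rewrite expn0 powR1 expr0.
by rewrite expnS natrM powRM// IH exprS.
Qed.

End Auxiliary.

(** * Expected numbers of hits *)

Section WeightedCount.
Variables (R : realType) (a : R).
Hypothesis a_ge0 : 0 <= a.
Implicit Types (A : set nat) (c g : R).
Local Notation count A N := ((counting_fun A N)%:R : R).

Definition expected_hits A N : R := expected_count (fun n => n%:R `^ (- a)) A N.

Lemma expected_hitsS A N :
  expected_hits A N.+1 = expected_hits A N + \1_A N.+1 * N.+1%:R `^ (- a).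
Proof. by rewrite /expected_hits /expected_count big_nat_recr. Qed.

(** Each of the [counting_fun A N] terms of the sum is at least
    [N ^ (- a)]. *)
Lemma expected_hits_ge A N : N%:R `^ (- a) * count A N <= expected_hits A N.
Proof.
rewrite counting_funE mulr_sumr; apply: ler_sum_nat => n /andP[n0 nN].
rewrite mulrC ler_wpM2l// !powRN lef_pV2 ?posrE ?natr_powR_gt0//; last first.
  exact: leq_trans n0 _.
exact: ler_nat_powR.
Qed.

Lemma expected_hits_step A M N : (0 < M)%N -> (M <= N)%N ->
  expected_hits A N <= expected_hits A M + M%:R `^ (- a) * count A N.
Proof.
move=> M0 MN; rewrite /expected_hits /expected_count (@big_cat_nat _ _ _ M.+1)//= lerD2l.
rewrite counting_funE mulr_sumr.
rewrite [leRHS](@big_cat_nat _ _ _ M.+1)//=.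
apply: (@le_trans _ _ (\sum_(M.+1 <= i < N.+1) M%:R `^ (- a) * \1_A i)).
  apply: ler_sum_nat => n /andP[Mn nN].
  rewrite mulrC ler_wpM2r// !powRN lef_pV2 ?posrE ?natr_powR_gt0//.
    by apply: ler_nat_powR => //; exact: ltnW.
  exact: leq_trans Mn.
by rewrite lerDr sumr_ge0// => n _; rewrite mulr_ge0// powR_ge0.
Qed.

(** Between [2 ^ k] and [2 ^ k.+1] the sum grows by at most [b] times
    [(2 ^ k) ^ (g - a)], with [b = c * 2 ^ g]. These increments form a geometric
    progression of ratio [x = 2 ^ (g - a) > 1], dominated by its last term. *)
Lemma expected_hits_dyadic A c g : a < g ->
  (forall N, (0 < N)%N -> count A N <= c * N%:R `^ g) ->
  exists K, forall k, expected_hits A (2 ^ k) <= K * (2 ^ k)%:R `^ (g - a).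
Proof.
move=> ag cA; have ga : 0 < g - a by lra.
have c0 : 0 <= c.
  by have := cA 1%N isT; rewrite powR1 mulr1; apply: le_trans.
pose x : R := 2 `^ (g - a).
have x1 : 1 < x.
  have : (1 : R) `^ (g - a) < x by rewrite gt0_ltr_powR// ?nnegrE// ltr1n.
  by rewrite powR1.
pose b := c * 2 `^ g.
have b0 : 0 <= b by rewrite mulr_ge0// powR_ge0.
(* Chosen so that K + b <= K * x, the induction step, and 1 <= K, its start. *)
pose K := Num.max 1 (b / (x - 1)).
have K1 : 1 <= K by rewrite le_max lexx.
have Kb : b <= K * (x - 1).
  by rewrite -ler_pdivrMr ?subr_gt0// le_max lexx orbT.
exists K; elim=> [|k IH].
  rewrite expn0 /expected_hits /expected_count big_nat1 powR1 !mulr1 indicE.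
  by apply: le_trans K1; rewrite lern1 leq_b1.
have k0 n : (0 < 2 ^ n)%N by rewrite expn_gt0.
apply: le_trans (expected_hits_step A (k0 k) _) _; first by rewrite leq_exp2l.
apply: (@le_trans _ _ (K * (2 ^ k)%:R `^ (g - a) + b * (2 ^ k)%:R `^ (g - a))).
  apply: lerD => //; apply: (@le_trans _ _
    ((2 ^ k)%:R `^ (- a) * (c * (2 ^ k.+1)%:R `^ g))).
    by apply: ler_wpM2l; rewrite ?powR_ge0// cA.
  rewrite natr_powRD// expnS natrM powRM// /b.
  rewrite le_eqVlt; apply/orP; left; apply/eqP; ring.
rewrite expnS natrM powRM// -/x.
have y0 := powR_ge0 ((2 ^ k)%:R : R) (g - a); nra.
Qed.

(** The tangent of [n ^ (1 - a) / (1 - a)] at [n] has slope [n ^ (- a)], which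
    is therefore at most the increment from [n - 1] to [n]; the next lemma uses
    that it is at least the increment from [n] to [n + 1]. *)
Lemma expected_hits_posnats_le N : a < 1 ->
  expected_hits posnats N <= N%:R `^ (1 - a) / (1 - a).
Proof.
move=> a1; elim: N => [|N IH].
  by rewrite /expected_hits /expected_count big_geq// divr_ge0 ?powR_ge0//; lra.
rewrite expected_hitsS; apply: le_trans (lerD IH (lexx _)) _.
have -> : \1_posnats N.+1 = 1 :> R by rewrite indicE mem_set.
rewrite mul1r -lerBrDl -mulrBl ler_pdivlMr; last lra.
have [->|a0] := eqVneq a 0.
  by rewrite oppr0 powRr0 addr0 !powRr1// -natr1; lra.
have a0' : 0 < a by rewrite lt_neqAle eq_sym a0.
have := @powR_tangent R N.+1%:R N%:R (1 - a).
have -> : 1 - a - 1 = - a by ring.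
have -> : (N%:R - N.+1%:R : R) = -1 by rewrite -natr1; ring.
move=> /(_ ltac:(lra) ltac:(lra) (ltr0Sn _ _) (ler0n _ _)); lra.
Qed.

Lemma expected_hits_posnats_ge N : a < 1 ->
  (N%:R `^ (1 - a) - 1) / (1 - a) <= expected_hits posnats N.
Proof.
move=> a1; have s0 : 0 < 1 - a by lra.
apply: (@le_trans _ _ ((N.+1%:R `^ (1 - a) - 1) / (1 - a))).
  rewrite ler_wpM2r ?invr_ge0 ?(ltW s0)// lerD2r.
  by apply: ler_nat_powR; rewrite ?(ltW s0).
elim: N => [|N IH].
  by rewrite powR1 subrr mul0r /expected_hits /expected_count big_geq.
rewrite expected_hitsS; apply: le_trans (lerD IH (lexx _)).
have -> : \1_posnats N.+1 = 1 :> R by rewrite indicE mem_set.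
rewrite mul1r -lerBlDl -mulrBl ler_pdivrMr//.
have [->|a0] := eqVneq a 0.
  by rewrite oppr0 powRr0 addr0 !powRr1// -[N.+2%:R]natr1; lra.
have a0' : 0 < a by rewrite lt_neqAle eq_sym a0.
have := @powR_tangent R N.+1%:R N.+2%:R (1 - a).
have -> : 1 - a - 1 = - a by ring.
have -> : (N.+2%:R - N.+1%:R : R) = 1 by rewrite -[N.+2%:R]natr1; ring.
move=> /(_ ltac:(lra) ltac:(lra) (ltr0Sn _ _) (ler0n _ _)); lra.
Qed.

End WeightedCount.

(** * From a subsequence to all integers *)

Section Interpolation.
Variable R : realType.

Lemma between_values (phi : nat -> nat) k0 N :
  (forall k, (k <= phi k)%N) -> (phi k0 <= N)%N ->
  exists k, (k0 <= k)%N /\ (phi k <= N <= phi k.+1)%N.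
Proof.
move=> kphi hN.
have ex : exists k, (k0 <= k)%N && (phi k <= N)%N by exists k0; rewrite leqnn.
have bd k : (k0 <= k)%N && (phi k <= N)%N -> (k <= N)%N.
  by move=> /andP[_ h]; exact: leq_trans (kphi k) h.
case: (ex_maxnP ex bd) => k /andP[hk kN] max; exists k; split=> //.
rewrite kN /= leqNgt; apply/negP => h.
have := max k.+1; rewrite (leqW hk) ltnW// => /(_ isT); by rewrite ltnn.
Qed.

(** For monotone [f] and [g], the quotient [f N / g N] lies between
    [f (phi k) / g (phi k.+1)] and [f (phi k.+1) / g (phi k)] when
    [phi k <= N <= phi k.+1], and these differ from the quotients along [phi] by
    factors that tend to 1. *)
Lemma cvg_along (f g : nat -> R) (phi : nat -> nat) (L : R) :
  (forall m n, (m <= n)%N -> f m <= f n) -> (forall n, 0 <= f n) ->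
  (forall m n, (m <= n)%N -> g m <= g n) ->
  (forall n, (0 < n)%N -> 0 < g n) ->
  (forall k, (k < phi k)%N) ->
  f (phi k) / g (phi k) @[k --> \oo] --> L ->
  g (phi k.+1) / g (phi k) @[k --> \oo] --> (1 : R) ->
  f N / g N @[N --> \oo] --> L.
Proof.
move=> mf f0 mg g0 kphi fL g1.
have phi0 k : (0 < phi k)%N by exact: leq_ltn_trans (kphi k).
have gphi k : 0 < g (phi k) by exact: g0.
have h1 : f (phi k.+1) / g (phi k) @[k --> \oo] --> L.
  have fL' : f (phi k.+1) / g (phi k.+1) @[k --> \oo] --> L.
    by have := fL; rewrite -cvg_shiftS.
  have -> : (fun k => f (phi k.+1) / g (phi k)) =
      (fun k => f (phi k.+1) / g (phi k.+1) * (g (phi k.+1) / g (phi k))).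
    by apply/funext => k; rewrite mulrA divfK// gt_eqF.
  by rewrite -[L]mulr1; exact: cvgM.
have h2 : f (phi k) / g (phi k.+1) @[k --> \oo] --> L.
  have -> : (fun k => f (phi k) / g (phi k.+1)) =
      (fun k => f (phi k) / g (phi k) / (g (phi k.+1) / g (phi k))).
    by apply/funext => k; field; rewrite !gt_eqF.
  by rewrite -[L]divr1; apply: cvgM fL _; apply: cvgV g1; exact: oner_neq0.
apply/cvgrPdist_le => e e0.
move/cvgrPdist_le : h1 => /(_ _ e0) [k1 _ h1].
move/cvgrPdist_le : h2 => /(_ _ e0) [k2 _ h2].
exists (phi (maxn k1 k2)) => // N /= hN.
have [k [hk /andP[kN Nk]]] := between_values (fun k => ltnW (kphi k)) hN.
move: hk; rewrite geq_max => /andP[hk1 hk2].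
have N0 : (0 < N)%N by exact: leq_trans (phi0 k) kN.
have u1 : f N / g N <= f (phi k.+1) / g (phi k).
  by rewrite ler_pM// ?invr_ge0 ?(ltW (g0 _ N0))// ?mf// lef_pV2 ?posrE ?g0// mg.
have u2 : f (phi k) / g (phi k.+1) <= f N / g N.
  by rewrite ler_pM// ?invr_ge0 ?(ltW (gphi _))// ?mf// lef_pV2 ?posrE ?g0// mg.
have := h1 k hk1; have := h2 k hk2; rewrite /= !ler_distl => /andP[a1 a2] /andP[b1 b2].
apply/andP; split; lra.
Qed.

End Interpolation.

(** * Almost sure size of the set of hits *)

Section AlmostSure.
Variables (R : realType) (a delta : R) (u : nat -> R) (I : nat -> set R) (l : nat).
Hypotheses (a_gt0 : 0 < a) (delta_ge0 : 0 <= delta).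
Hypothesis u_subl : sublacunary delta u.
Hypothesis I_meas : forall n : nat, (0 < n)%N ->
  mu (I n) = (n%:R `^ (- a))%:E.
Hypothesis I_itv : forall n : nat, (0 < n)%N ->
  I n `<=` [set` `[0, 1]] /\ union_of_intervals l (I n).
Local Notation D := (`[0, 1]%classic : set R).
Local Notation count A N := ((counting_fun A N)%:R : R).
Local Notation p := (fun n : nat => n%:R `^ (- a) : R).

(** Index 0 is given the empty set, because nothing is known about [I 0]. *)
Definition hit_event (n : nat) : set R :=
  if n is 0 then set0 else hitset (u n) (I n).

Lemma measurable_hit_event n : measurable (hit_event n).
Proof.
case: n => [|n] //=; apply: measurable_hitset.
by have [_ /union_of_intervals_measurable] := I_itv (ltn0Sn n).
Qed.

Lemma len_target n : (0 < n)%N -> len (I n) = p n.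
Proof. by move=> n0; rewrite /len I_meas. Qed.

(** Bounds the error terms of [hitset_cov] and [len_hitset_close] by multiples
    of [u m / u n], using that [u m] is at least [u 1]. *)
Lemma hit_cov : exists C : R, 0 <= C /\ forall m n, (0 < m <= n)%N ->
  cov hit_event p m n <= C * (p n * (u m / u n)).
Proof.
have [_ u0 _] := u_subl; have u1 := u0 1%N isT.
have ui : 0 < (u 1%N)^-1 by rewrite invr_gt0.
pose B : R := 2 ^+ l; have B0 : 0 <= B by rewrite exprn_ge0.
exists (2 * B * (1 + (u 1%N)^-1) + 2 * (u 1%N)^-1); split.
  by rewrite addr_ge0// !mulr_ge0// ?addr_ge0// ltW.
move=> m n /andP[m0 mn]; have n0 : (0 < n)%N := leq_trans m0 mn.
have um := u0 _ m0; have un := u0 _ n0.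
have [In01 /union_of_intervals_measurable mIn] := I_itv n0.
have [_ Im] := I_itv m0.
have hE k : (0 < k)%N -> hit_event k = hitset (u k) (I k) by case: k.
rewrite /cov !hE//.
have h1 := hitset_cov um un Im mIn In01.
have h2 := len_hitset_close un mIn In01.
move: h1 h2; rewrite len_target// -/B.
set x := len _; set y := len (_ `&` D); set z := len (_ `&` D).
set pn := n%:R `^ (- a); set pm := m%:R `^ (- a) => h1.
rewrite ler_distl => /andP[h2 _].
have pn0 : 0 <= pn by exact: powR_ge0.
have pm0 : 0 <= pm by exact: powR_ge0.
have pm1 : pm <= 1.
  rewrite /pm powRN invf_le1 ?natr_powR_gt0// -[leLHS](@powRr0 R m%:R).
  by rewrite ler_powR ?ler1n ?ltW.
set q := pn / u n in h1 h2; have q0 : 0 <= q by rewrite divr_ge0// ltW.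
have -> : pn * (u m / u n) = q * u m by rewrite /q mulrAC mulrA.
have h3 : pm * (pn - z) <= 2 * q.
  apply: (@le_trans _ _ (pm * (2 * q))); first by apply: ler_wpM2l => //; lra.
  by rewrite ler_piMl// mulr_ge0.
have um1 : 1 <= u m * (u 1%N)^-1.
  by rewrite ler_pdivlMr// mul1r (sublacunary_ge u_subl).
have h4 : q * 1 <= q * (u m * (u 1%N)^-1) by apply: ler_wpM2l.
have h5 : B * (q * 1) <= B * (q * (u m * (u 1%N)^-1)) by apply: ler_wpM2l.
lra.
Qed.

Lemma hit_countE A N y : count (A `&` hits u I y) N = occurrences hit_event A N y.
Proof.
rewrite counting_funE; apply: eq_big_nat => n /andP[n0 _].
rewrite indicI /=; congr (_ * _); rewrite !indicE; congr (_%:R).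
congr nat_of_bool; apply/idP/idP => /set_mem h; apply/mem_set.
  by case: n n0 h => // n _ [].
by case: n n0 h => // n _ h; split.
Qed.

Lemma hit_deviation : exists C : R, 0 <= C /\ forall A N t, 0 < t ->
  len [set y | D y /\ t < `|count (A `&` hits u I y) N - expected_hits a A N|] <=
  C * (N%:R `^ delta * expected_hits a A N / t ^+ 2).
Proof.
have [_ u0 _] := u_subl.
have [C [C0 hC]] := hit_cov.
have [K [K0 hK]] := sublacunary_sum delta_ge0 u_subl.
exists (2 * C * K); split; first by rewrite !mulr_ge0.
move=> A N t t0; under eq_set do rewrite hit_countE.
rewrite mulrA; apply: (deviation A measurable_hit_event _ u0 C0 hC hK) => //.
Qed.

(** The Borel-Cantelli lemma applied to the events of [hit_deviation]. *)
Lemma ae_deviation (A : set nat) (phi : nat -> nat) (t : nat -> R) (c : R) :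
  (forall k, 0 < t k) ->
  (forall n, \sum_(k < n)
    (phi k)%:R `^ delta * expected_hits a A (phi k) / t k ^+ 2 <= c) ->
  ae01 (fun y => exists k0, forall k, (k0 <= k)%N ->
    `|count (A `&` hits u I y) (phi k) - expected_hits a A (phi k)| <= t k).
Proof.
move=> t0 hc; have [C [C0 hC]] := hit_deviation.
pose B k := [set y | D y /\
  t k < `|count (A `&` hits u I y) (phi k) - expected_hits a A (phi k)|].
have mB k : measurable (B k).
  pose f y : R :=
    `|occurrences hit_event A (phi k) y - expected_hits a A (phi k)|.
  have mf : measurable_fun D f.
    rewrite /f.
    apply: measurableT_comp => //; apply: measurable_funB => //.
    have [] := @bmeas_sum R (fun n y => \1_A n * \1_(hit_event n) y) 1 (phi k).+1.
      move=> n; apply: bmeasM; first exact: bmeas_cst.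
      by apply: bmeas_indic; exact: measurable_hit_event.
    by [].
  have -> : B k = D `&` f @^-1` `]t k, +oo[.
    by rewrite /B /f; apply/seteqP; split=> y /=; rewrite hit_countE !in_itv/= andbT.
  exact: mf.
have BD k : B k `<=` D by move=> y [].
have := @borel_cantelli01 R B (C * c) mB BD.
have Bc n : \sum_(k < n) len (B k) <= C * c.
  apply: (@le_trans _ _ (C * \sum_(k < n)
      (phi k)%:R `^ delta * expected_hits a A (phi k) / t k ^+ 2)); last exact: ler_wpM2l.
  by rewrite mulr_sumr; apply: ler_sum => k _; exact: hC.
move=> /(_ Bc); apply: ae01_sub => y y01 [k0 hk]; exists k0 => k k0k.
by rewrite leNgt; apply/negP => h; apply: (hk k k0k).
Qed.

Let powR_lt1 (x : R) : 0 < x -> 0 <= (2 : R) `^ (- x) < 1.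
Proof.
move=> x0; rewrite powR_ge0/= powRN invf_lt1 ?powR_gt0//.
have : (1 : R) `^ x < 2 `^ x by rewrite gt0_ltr_powR// ?nnegrE// ltr1n.
by rewrite powR1.
Qed.

(** With [ka] slightly above [theta], the expected number of hits up to
    [N = 2 ^ k] is [O(N ^ ka)], and a deviation of size [N ^ (ka + e)] has
    measure [O(N ^ (delta - ka - 2 * e))], which is at most
    [O(2 ^ (- 2 * e * k))] as [delta <= ka]. *)
Lemma ae_upper_mdim_le A theta : delta <= theta ->
  (forall g, theta + a < g -> exists c,
     forall N, (0 < N)%N -> count A N <= c * N%:R `^ g) ->
  ae01 (fun y => upper_mdim R (A `&` hits u I y) <= theta).
Proof.
move=> dt hA.
have th0 : 0 <= theta by exact: le_trans dt.
suff H (j : nat) : ae01 (fun y =>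
    upper_mdim R (A `&` hits u I y) <= theta + 2 / j.+1%:R).
  by apply: ae01_sub (ae01_forall H) => y _ h; apply: (@le_addinv _ _ _ 2).
set e : R := j.+1%:R^-1; have e0 : 0 < e by rewrite invr_gt0.
pose ka := theta + e.
have [|c hc] := hA (ka + a); first by rewrite /ka; lra.
have [|K hK] := @expected_hits_dyadic R a (ltW a_gt0) A c (ka + a) _ hc.
  by rewrite /ka; lra.
have {}hK k : expected_hits a A (2 ^ k) <= K * (2 ^ k)%:R `^ ka.
  by have := hK k; rewrite addrK.
have p0 k x : 0 < (2 ^ k)%:R `^ x :> R by rewrite natr_powR_gt0// expn_gt0.
have K0 : 0 <= K.
  have := hK 0%N; rewrite expn0 powR1 mulr1; apply: le_trans.
  by apply: expected_count_ge0 => n _; exact: powR_ge0.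
pose x : R := 2 `^ (- (2 * e)).
have /andP[x0 x1] : 0 <= x < 1 by apply: powR_lt1; rewrite mulr_gt0.
have := @ae_deviation A (expn 2) (fun k => (2 ^ k)%:R `^ (ka + e)) (K / (1 - x)).
move=> /(_ (fun k => p0 k _)) H.
apply: ae01_sub (H _) => [y _ [k0 hk]|n]; last first.
  apply: (@le_trans _ _ (K * \sum_(k < n) x ^+ k)); last first.
    by apply: ler_wpM2l => //; exact: geometric_sum_le.
  rewrite mulr_sumr; apply: ler_sum => k _.
  rewrite ler_pdivrMr ?exprn_gt0//.
  apply: (@le_trans _ _ ((2 ^ k)%:R `^ delta * (K * (2 ^ k)%:R `^ ka))).
    by apply: ler_wpM2l => //; exact: powR_ge0.
  have k2 : (0 < 2 ^ k)%N by rewrite expn_gt0.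
  have -> : x ^+ k = (2 ^ k)%:R `^ (- (2 * e)) by rewrite natrX_powR.
  rewrite expr2 mulrCA -mulrA ler_wpM2l// -!natr_powRD//.
  apply: ler_powR; first by rewrite ler1n.
  by rewrite /ka; lra.
apply: (@upper_mdim_le _ _ ((K + 1) * 2 `^ (ka + e))).
  by rewrite addr_ge0// divr_ge0.
exists (2 ^ k0)%N => N hN.
have [k [k0k /andP[kN Nk]]] := @between_values (expn 2) k0 N
  (fun k => ltnW (ltn_expl k (ltnSn 1))) hN.
have : count (A `&` hits u I y) N <= count (A `&` hits u I y) (2 ^ k.+1).
  by rewrite ler_nat leq_counting_fun.
move/le_trans; apply.
have := hk k.+1 (leqW k0k); rewrite ler_distl => /andP[_]; move/le_trans; apply.
apply: (@le_trans _ _ ((K + 1) * (2 ^ k.+1)%:R `^ (ka + e))).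
  rewrite mulrDl mul1r lerD2r; apply: le_trans (hK _) _.
  apply: ler_wpM2l => //; apply: ler_powR; first by rewrite ler1n expn_gt0.
  lra.
rewrite expnS natrM powRM// mulrA.
have -> : theta + 2 / j.+1%:R = ka + e by rewrite /ka -/e; ring.
apply: ler_wpM2l; first by rewrite mulr_ge0 ?powR_ge0// addr_ge0.
by apply: ler_nat_powR => //; rewrite /ka !addr_ge0// ltW.
Qed.

(** The expected number [M] of hits up to [N = phi k] is at least
    [N ^ (g - a)]; a deviation of [M / 2] has measure
    [O(N ^ delta / M) = O(N ^ (delta + a - g))], which is geometrically small
    in [k]. *)
Lemma ae_count_ge (A : set nat) g (phi : nat -> nat) : delta + a < g ->
  (forall k, (2 ^ k <= phi k)%N) ->
  (forall k, (phi k)%:R `^ g <= count A (phi k)) ->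
  ae01 (fun y => exists k0, forall k, (k0 <= k)%N ->
    2^-1 * (phi k)%:R `^ (g - a) <= count (A `&` hits u I y) (phi k)).
Proof.
move=> dg phi2 phig.
have phi0 k : (0 < phi k)%N by apply: leq_trans (phi2 k); rewrite expn_gt0.
have p0 k z : 0 < (phi k)%:R `^ z :> R by exact: natr_powR_gt0.
have Mge k : (phi k)%:R `^ (g - a) <= expected_hits a A (phi k).
  apply: le_trans (expected_hits_ge (ltW a_gt0) _ _).
  by rewrite addrC natr_powRD// ler_wpM2l ?powR_ge0.
have M0 k : 0 < expected_hits a A (phi k) by exact: lt_le_trans (Mge k).
pose e := g - a - delta; have e0 : 0 < e by rewrite /e; lra.
pose x : R := 2 `^ (- e).
have /andP[x0 x1] : 0 <= x < 1 by exact: powR_lt1.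
have := @ae_deviation A phi (fun k => expected_hits a A (phi k) / 2) (4 / (1 - x)).
have t0 k : 0 < expected_hits a A (phi k) / 2 by rewrite divr_gt0.
move=> /(_ t0) H; apply: ae01_sub (H _) => [y _ [k0 hk]|n].
  exists k0 => k k0k; have := hk k k0k; rewrite ler_distl => /andP[h _].
  have := Mge k; lra.
apply: (@le_trans _ _ (4 * \sum_(k < n) x ^+ k)); last first.
  by apply: ler_wpM2l => //; exact: geometric_sum_le.
rewrite mulr_sumr; apply: ler_sum => k _.
have -> : (phi k)%:R `^ delta * expected_hits a A (phi k) /
    (expected_hits a A (phi k) / 2) ^+ 2
   = 4 * ((phi k)%:R `^ delta / expected_hits a A (phi k)).
  by field; rewrite gt_eqF.
apply: ler_wpM2l => //; rewrite ler_pdivrMr//.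
apply: (@le_trans _ _ (x ^+ k * (phi k)%:R `^ (g - a))); last first.
  by apply: ler_wpM2l; rewrite ?exprn_ge0.
have -> : g - a = delta + e by rewrite /e; ring.
rewrite natr_powRD// mulrCA ler_peMr// /x powRN exprVn mulrC.
rewrite ler_pdivlMr ?exprn_gt0 ?powR_gt0// mul1r -natrX_powR.
by apply: ler_nat_powR => //; exact: ltW.
Qed.

Lemma ae_upper_mdim_ge A : delta + a < upper_mdim R A ->
  ae01 (fun y => upper_mdim R A - a <= upper_mdim R (A `&` hits u I y)).
Proof.
move=> hA; have [e eE] : exists e, e = upper_mdim R A - delta - a by eexists.
have e0 : 0 < e by lra.
suff H (j : nat) : ae01 (fun y =>
    upper_mdim R A - a <= upper_mdim R (A `&` hits u I y) + e / j.+1%:R).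
  apply: ae01_sub (ae01_forall H) => y _ h; apply: (@le_addinv _ _ _ e) => //.
  exact: ltW.
have [q qE] : exists q, q = e / j.+2%:R by eexists.
have j2 : q <= e / j.+1%:R; rewrite ?qE.
  by rewrite ler_wpM2l ?(ltW e0)// lef_pV2 ?posrE// ler_nat.
have j0 : 0 < q by rewrite qE divr_gt0.
have j1 : q < e by rewrite qE ltr_pdivrMr// ltr_pMr// ltr1n.
(* Since q < e, the exponent g still exceeds delta + a. *)
pose g := upper_mdim R A - q.
have dg : delta + a < g by rewrite /g; lra.
have g0 : 0 <= g by apply: ltW; apply: le_lt_trans dg; rewrite addr_ge0// ltW.
have gA : g < upper_mdim R A by rewrite /g; lra.
have ex := lt_upper_mdim g0 gA.
have [phi hphi] := @choice _ _ (fun k N => (2 ^ k <= N)%N /\ N%:R `^ g <= count A N)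
  (fun k => ex (2 ^ k)%N).
apply: ae01_sub (ae_count_ge dg (fun k => (hphi k).1) (fun k => (hphi k).2)).
move=> y _ [k0 hk].
suff : g - a <= upper_mdim R (A `&` hits u I y).
  move=> hg; rewrite [leLHS](_ : _ = g - a + q); first exact: lerD.
  by rewrite /g addrAC subrK.
apply: (@upper_mdim_ge _ _ 2^-1) => // N0.
exists (phi (maxn k0 N0)); split; last by apply: hk; exact: leq_maxl.
apply: leq_trans (hphi _).1; apply: leq_trans (leq_maxr k0 N0) _.
exact: ltnW (ltn_expl _ (ltnSn 1)).
Qed.

Lemma ae_lower_mdim_ge A : delta + a < lower_mdim R A ->
  ae01 (fun y => lower_mdim R A - a <= lower_mdim R (A `&` hits u I y)).
Proof.
move=> hA; have [e eE] : exists e, e = lower_mdim R A - delta - a by eexists.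
have e0 : 0 < e by lra.
suff H (j : nat) : ae01 (fun y =>
    lower_mdim R A - a <= lower_mdim R (A `&` hits u I y) + e / j.+1%:R).
  apply: ae01_sub (ae01_forall H) => y _ h; apply: (@le_addinv _ _ _ e) => //.
  exact: ltW.
have [q qE] : exists q, q = e / j.+2%:R by eexists.
have j2 : q <= e / j.+1%:R; rewrite ?qE.
  by rewrite ler_wpM2l ?(ltW e0)// lef_pV2 ?posrE// ler_nat.
have j0 : 0 < q by rewrite qE divr_gt0.
have j1 : q < e by rewrite qE ltr_pdivrMr// ltr_pMr// ltr1n.
(* Since q < e, the exponent g still exceeds delta + a. *)
pose g := lower_mdim R A - q.
have dg : delta + a < g by rewrite /g; lra.
have g0 : 0 <= g by apply: ltW; apply: le_lt_trans dg; rewrite addr_ge0// ltW.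
have ga0 : 0 <= g - a by have d0 := delta_ge0; lra.
have gA : g < lower_mdim R A by rewrite /g; lra.
have [N0 hN0] := lt_lower_mdim g0 gA.
pose phi k := (2 ^ (k + N0))%N.
have phi2 k : (2 ^ k <= phi k)%N by rewrite leq_exp2l// leq_addr.
have phiN k : (N0 <= phi k)%N.
  by apply: leq_trans (leq_addl k N0) _; exact: ltnW (ltn_expl _ (ltnSn 1)).
apply: ae01_sub (ae_count_ge dg phi2 (fun k => hN0 _ (phiN k))).
move=> y _ [k0 hk].
suff : g - a <= lower_mdim R (A `&` hits u I y).
  move=> hg; rewrite [leLHS](_ : _ = g - a + q); first exact: lerD.
  by rewrite /g addrAC subrK.
have c0 : 0 < 2^-1 / 2 `^ (g - a) :> R by rewrite divr_gt0// powR_gt0.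
apply: (lower_mdim_ge c0); exists (phi k0) => N hN.
have [|k [k0k /andP[kN Nk]]] := @between_values phi k0 N _ hN.
  move=> k; apply: leq_trans (leq_addr N0 k) _.
  exact: ltnW (ltn_expl _ (ltnSn 1)).
apply: (@le_trans _ _ (2^-1 * (phi k)%:R `^ (g - a))).
  rewrite mulrAC ler_pdivrMr ?powR_gt0// -mulrA -powRM// mulrC -natrM mulrC.
  by rewrite ler_wpM2l// ler_nat_powR// /phi -expnSr -addSn.
by apply: le_trans (hk k k0k) _; rewrite ler_nat leq_counting_fun.
Qed.

(** Along [N = k.+1 ^ r], a relative deviation of [k.+1^-1] has measure
    [O(k.+1 ^ 2 * N ^ (delta + a - 1))], which is summable for [r] large, while
    consecutive values of [N ^ (1 - a)] still have ratio tending to 1. *)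
Lemma ae_counting_asymptotics : delta + a < 1 ->
  ae01 (fun y => count (hits u I y) N / N%:R `^ (1 - a) @[N --> \oo] --> (1 - a)^-1).
Proof.
move=> da1; have dl0 := delta_ge0; have a0 := a_gt0.
have s0 : 0 < 1 - a by lra.
pose e := 1 - a - delta; have e0 : 0 < e by rewrite /e; lra.
(* With r * e >= 4, the bound k^2 * (k^r)^(- e) is at most k^(- 2). *)
pose r := (Num.truncn (4 / e)).+1.
have re : 4 <= r%:R * e by rewrite -ler_pdivrMr// ltW// truncnS_gt.
have rs : 4 <= r%:R * (1 - a).
  apply: le_trans re _; apply: ler_wpM2l => //; rewrite /e; lra.
pose phi k := (k.+1 ^ r)%N.
have phi0 k : (0 < phi k)%N by rewrite expn_gt0.
have p0 k z : 0 < (phi k)%:R `^ z :> R by exact: natr_powR_gt0.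
have pE k z : (phi k)%:R `^ z = k.+1%:R `^ (r%:R * z) :> R.
  by rewrite /phi natrX_powR -powR_mulrn ?powR_ge0// -powRrM mulrC.
have M1 N : N%:R `^ (1 - a) <= expected_hits a posnats N.
  case: N => [|N].
    by rewrite powR0 ?gt_eqF// expected_count_ge0// => n _; exact: powR_ge0.
  apply: le_trans (expected_hits_ge (ltW a_gt0) _ _); rewrite addrC natr_powRD//.
  by rewrite ler_wpM2l ?powR_ge0// powRr1// counting_fun_posnats.
have M0 k : 0 < expected_hits a posnats (phi k) by exact: lt_le_trans (M1 _).
have t0 k : 0 < expected_hits a posnats (phi k) / k.+1%:R by rewrite divr_gt0.
have H := @ae_deviation posnats phi (fun k => expected_hits a posnats (phi k) / k.+1%:R)
  2 t0.
have posI y : posnats `&` hits u I y = hits u I y.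
  by apply/setIidPr => n [].
apply: ae01_sub (H _) => [y _ [k0 hk]|n]; last first.
  apply: le_trans (inverse_square_sum_le R n); apply: ler_sum => k _.
  have k1 : 0 < k.+1%:R :> R by [].
  have -> : (phi k)%:R `^ delta * expected_hits a posnats (phi k) /
     (expected_hits a posnats (phi k) / k.+1%:R) ^+ 2 =
     k.+1%:R ^+ 2 * (phi k)%:R `^ delta / expected_hits a posnats (phi k).
    by field; rewrite !gt_eqF.
  rewrite ler_pdivrMr//; apply: (@le_trans _ _ (k.+1%:R ^- 2 * (phi k)%:R `^ (1 - a))).
    have -> : 1 - a = delta + e by rewrite /e; ring.
    rewrite natr_powRD// mulrCA mulrC ler_wpM2l ?powR_ge0//.
    rewrite ler_pdivlMl ?exprn_gt0// -exprD pE -powR_mulrn//.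
    by apply: ler_powR => //; rewrite ler1n.
  by apply: ler_wpM2l => //; rewrite invr_ge0 exprn_ge0.
have gN n : (0 < n)%N -> 0 < n%:R `^ (1 - a) :> R by exact: natr_powR_gt0.
have inv_cvg0 : (k.+1%:R^-1 : R) @[k --> \oo] --> (0 : R) by exact: cvg_harmonic.
apply: (@cvg_along R (fun N => count (hits u I y) N) (fun N => N%:R `^ (1 - a)) phi) => //.
- by move=> m n mn; rewrite ler_nat leq_counting_fun.
- by move=> m n mn; apply: ler_nat_powR => //; exact: ltW.
- move=> k; rewrite /phi -[X in (X <= _)%N]expn1.
  by case: k => [|k]; rewrite ?exp1n// leq_exp2l.
- apply/cvgrPdist_le => d d0.
  have c0 : 0 < (1 - a) * d / 2 by rewrite divr_gt0// mulr_gt0.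
  move/cvgrPdist_le : inv_cvg0 => /(_ _ c0) [k1 _ hk1].
  exists (maxn k0 k1) => // k /=; rewrite geq_max => /andP[k0k k1k].
  have := hk1 k k1k; rewrite /= sub0r normrN ger0_norm ?invr_ge0// => hinv.
  have := hk k k0k; rewrite posI.
  set M := expected_hits a posnats (phi k); set S := count _ _.
  set G := (phi k)%:R `^ (1 - a).
  have G0 : 0 < G by exact: p0.
  have GI : G^-1 <= k.+1%:R^-1.
    rewrite lef_pV2 ?posrE// /G pE -[leLHS]powRr1//; apply: ler_powR.
      by rewrite ler1n.
    lra.
  have := @expected_hits_posnats_le R a (ltW a_gt0) (phi k) ltac:(lra).
  have := @expected_hits_posnats_ge R a (ltW a_gt0) (phi k) ltac:(lra).
  rewrite -/M -/G => Mge Mle hS.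
  set w := (1 - a)^-1 in Mle Mge *; set i := k.+1%:R^-1 in hinv GI hS.
  have w0 : 0 < w by rewrite invr_gt0.
  have wi : w * i <= d / 2.
    by rewrite /w mulrC ler_pdivrMr// mulrC mulrA.
  have GwI : G * (w * i) <= G * (d / 2) by rewrite ler_pM2l.
  have i0 : 0 <= i by rewrite invr_ge0.
  have Mi : M * i <= G * (d / 2).
    by apply: le_trans GwI; rewrite mulrA ler_wpM2r.
  have wG : w <= G * (d / 2).
    apply: le_trans GwI; rewrite mulrCA ler_peMr ?(ltW w0)//.
    by rewrite -ler_pdivrMl// mulr1.
  rewrite ler_distl in hS; have /andP[hS1 hS2] := hS.
  rewrite ler_distl lerBlDr ler_pdivrMr// -lerBlDr ler_pdivlMr//.
  apply/andP; split; lra.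
- pose rho k : R := (k.+2%:R / k.+1%:R) `^ (1 - a).
  have rhoE k : (phi k.+1)%:R `^ (1 - a) / (phi k)%:R `^ (1 - a) = rho k ^+ r.
    rewrite /phi !natrX_powR -expr_div_n; congr (_ ^+ _).
    by rewrite /rho powRM// ?invr_ge0// -powR_inv1// -powRrM mulN1r powRN.
  under eq_fun do rewrite rhoE.
  have rho1 : rho k @[k --> \oo] --> (1 : R).
    have q1 k : k.+2%:R / k.+1%:R = 1 + k.+1%:R^-1 :> R.
      by rewrite -[k.+2%:R]natr1 mulrDl divff// mul1r.
    apply: (@squeeze_cvgr _ _ _ _ (fun=> 1) (fun k => 1 + k.+1%:R^-1)).
    + apply: nearW => k; rewrite /rho q1.
      have q2 : 1 <= 1 + k.+1%:R^-1 :> R by rewrite lerDl invr_ge0.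
      rewrite ler1_powR//; last lra.
      have := ler_powR q2 (ltW s0); by rewrite powRr0 => ->.
    + exact: cvg_cst.
    + by rewrite -[X in _ --> X]addr0; apply: cvgD => //; exact: cvg_cst.
  elim: (r) => [|m IH].
    under eq_fun do rewrite expr0.
    exact: cvg_cst.
  under eq_fun do rewrite exprS.
  by have := cvgM rho1 IH; rewrite mulr1; apply.
Qed.

Lemma ae_upper_mdim A : delta + a < upper_mdim R A ->
  ae01 (fun y => upper_mdim R (A `&` hits u I y) = upper_mdim R A - a).
Proof.
move=> hA.
have ge := ae_upper_mdim_ge hA.
have le := @ae_upper_mdim_le A (upper_mdim R A - a) ltac:(lra).
apply: ae01_sub (ae01_and ge (le _)) => [y _ [h1 h2]|g].
  by apply/eqP; rewrite eq_le h1 h2.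
by rewrite subrK => /upper_mdim_lt.
Qed.

Lemma ae_is_mdim A d : is_mdim A d -> delta + a < d ->
  ae01 (fun y => is_mdim (A `&` hits u I y) (d - a)).
Proof.
move=> [lA uA] hd.
have hl : delta + a < lower_mdim R A by rewrite lA.
have hu : delta + a < upper_mdim R A by rewrite uA.
have ge := ae_lower_mdim_ge hl.
apply: ae01_sub (ae01_and ge (ae_upper_mdim hu)) => y _ [h1 h2].
split; last by rewrite h2 uA.
apply/eqP; rewrite eq_le -{2}lA h1 andbT -uA -h2; exact: lower_mdim_le_upper.
Qed.

Lemma is_mdim_posnats : is_mdim posnats (1 : R).
Proof.
have lP : 1 <= lower_mdim R posnats.
  apply: (@lower_mdim_ge _ _ 1) => //; exists 0%N => N _.
  by rewrite mul1r powRr1// counting_fun_posnats.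
have lu := lower_mdim_le_upper R posnats; have u1 := upper_mdim_le1 R posnats.
by split; apply/eqP;
  rewrite eq_le ?u1 ?lP ?(le_trans lu u1) ?(le_trans lP lu).
Qed.

(** The set of all indices has dimension 1. *)
Lemma ae_is_mdim_hits : delta + a < 1 ->
  ae01 (fun y => is_mdim (hits u I y) (1 - a)).
Proof.
move=> da1; apply: ae01_sub (ae_is_mdim is_mdim_posnats da1) => y _.
by have -> : posnats `&` hits u I y = hits u I y by apply/setIidPr => n [].
Qed.
End AlmostSure.

(* The limit is 1 / (1 - a), not 1: the measures n^(-a) of the I n add up over
   1 <= n <= N to N^(1 - a) / (1 - a), asymptotically. *)
Theorem theoremA (R : realType) (a delta : R) (u : nat -> R)
    (I : nat -> set R) (l : nat)
    (a_gt0 : 0 < a) (a_lt1 : a < 1)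
    (delta_ge0 : 0 <= delta) (delta_lt1 : delta < 1)
    (u_subl : sublacunary delta u)
    (I_meas : forall n : nat, (0 < n)%N ->
       lebesgue_measure (I n) = (n%:R `^ (- a))%:E)
    (l_gt0 : (0 < l)%N)
    (I_itv : forall n : nat, (0 < n)%N ->
       I n `<=` [set` `[0, 1]] /\ union_of_intervals l (I n)) :
  [/\ delta + a < 1 ->
        ae01 (fun y =>
          (counting_fun (hits u I y) N)%:R / N%:R `^ (1 - a)
            @[N --> \oo] --> (1 - a)^-1),
      forall A : set nat, A `<=` posnats ->
        delta + a < upper_mdim R A ->
        ae01 (fun y => exists d : R,
          [/\ is_mdim (hits u I y) d,
              upper_mdim R (A `&` hits u I y) = upper_mdim R A + d - 1 &
              upper_mdim R A + d - 1 = upper_mdim R A - a])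
        /\
        (forall dA : R, is_mdim A dA ->
         ae01 (fun y => exists d : R,
           [/\ is_mdim (hits u I y) d,
               is_mdim (A `&` hits u I y) (dA + d - 1) &
               dA + d - 1 = dA - a])) &
      forall A : set nat, A `<=` posnats ->
        upper_mdim R A < a -> delta = 0 ->
        ae01 (fun y => is_mdim (A `&` hits u I y) (0 : R))].
Proof.
split.
- exact: ae_counting_asymptotics a_gt0 delta_ge0 u_subl I_meas I_itv.
- move=> A _ hA.
  have da1 : delta + a < 1 by apply: lt_le_trans hA (upper_mdim_le1 R A).
  have hits_dim := ae_is_mdim_hits a_gt0 delta_ge0 u_subl I_meas I_itv da1.
  have shift (x : R) : x + (1 - a) - 1 = x - a by ring.
  split=> [|dA A_dim].
    have A_upper := ae_upper_mdim a_gt0 delta_ge0 u_subl I_meas I_itv hA.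
    apply: ae01_sub (ae01_and hits_dim A_upper) => y _ [hy Ay].
    by exists (1 - a); rewrite shift.
  have hd : delta + a < dA by case: A_dim => _ <-.
  have A_mdim := ae_is_mdim a_gt0 delta_ge0 u_subl I_meas I_itv A_dim hd.
  apply: ae01_sub (ae01_and hits_dim A_mdim) => y _ [hy Ay].
  by exists (1 - a); rewrite shift.
- move=> A _ hA delta0.
  have le := @ae_upper_mdim_le R a delta u I l a_gt0 delta_ge0 u_subl I_meas
    I_itv A 0.
  rewrite delta0 in le.
  apply: ae01_sub (le (lexx 0) _) => [y _ h|g].
    have l0 := lower_mdim_ge0 R (A `&` hits u I y).
    have lu := lower_mdim_le_upper R (A `&` hits u I y).
    by split; apply/eqP;
      rewrite eq_le ?h ?l0 ?(le_trans lu h) ?(le_trans l0 lu).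
  by rewrite add0r => ag; apply: upper_mdim_lt; exact: lt_trans ag.
Qed.
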